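(* Let $\lambda$ be a Ferrers shape and let $\mathbf a=(a_1,a_2,\dots)$ be a finite sequence of positive integers. Then $$\bigl|W^{(a_1,a_2,\dots)}_\lambda(\{231,221\})\bigr|=\bigl|W^{(a_1,a_2,\dots)}_\lambda(\{312,212\})\bigr|.$$ That is, the sets of patterns $\{231,221\}$ and $\{312,212\}$ are shape-Wilf-equivalent for words.
   Context: A Ferrers shape $\lambda=(\lambda_1,\lambda_2,\dots)$ with $\lambda_1\ge\lambda_2\ge\cdots$ is drawn in French convention: a left-justified arrangement of cells with $\lambda_i$ cells in row $i$, rows numbered from bottom (row 1) to top; columns are numbered from left to right. A $0$-$1$-filling of $\lambda$ assigns $0$ or $1$ to each cell. For a word $x=x_1x_2\cdots x_r$ over the positive integers with largest letter $M$, let $M(x)$ be the $M\times r$ $0$-$1$ matrix (rows numbered bottom to top) having a $1$ in row $x_j$ of column $j$ for each $j$, and $0$ elsewhere. A filling $F$ of $\lambda$ contains $x$ if there are rows $\rho_1<\rho_2<\dots<\rho_M$ and columns $c_1<c_2<\dots<c_r$ such that every cell (row $\rho_l$, column $c_j$) lies in $\lambda$ and the entries of $F$ in these cells form exactly the matrix $M(x)$; otherwise $F$ avoids $x$. For a set $\Omega$ of words, $W^{(a_1,a_2,\dots)}_\lambda(\Omega)$ denotes the set of $0$-$1$-fillings of $\lambda$ with exactly one $1$ in each column, exactly $a_i$ ones in row $i$ for each $i$, and which avoid every word in $\Omega$. Two sets of words $\Omega,\Sigma$ are shape-Wilf-equivalent for words if $|W^{(a_1,a_2,\dots)}_\lambda(\Omega)|=|W^{(a_1,a_2,\dots)}_\lambda(\Sigma)|$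 for all finite sequences of positive integers $a_1,a_2,\dots$ and all Ferrers shapes $\lambda$. *)

(* Defs.v *)
From mathcomp Require Import all_boot.
Set Implicit Arguments. Unset Strict Implicit. Unset Printing Implicit Defensive.

(* Rows and columns are 0-indexed here: row i (0-based) is the paper's row i+1
   (rows counted from the bottom), column c (0-based) is the paper's column c+1. *)

(* A Ferrers shape: weakly decreasing sequence of positive row lengths,
   lam = [:: lambda_1; lambda_2; ...], lambda_1 = bottom row. *)
Definition ferrers (lam : seq nat) : bool :=
  sorted geq lam && all (fun k => 0 < k) lam.

Definition nrows (lam : seq nat) : nat := size lam.
Definition ncols (lam : seq nat) : nat := head 0 lam.

Definition in_shape (lam : seq nat) (i c : nat) : bool := c < nth 0 lam i.

(* A 0-1 filling of lam, stored on the bounding rectangle; cells outside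
   lam are required to be 0 (see [is_filling]). *)
Definition filling (lam : seq nat) := {ffun 'I_(nrows lam) * 'I_(ncols lam) -> bool}.

Definition is_filling (lam : seq nat) (F : filling lam) : bool :=
  [forall i : 'I_(nrows lam), forall c : 'I_(ncols lam),
     ~~ in_shape lam i c ==> ~~ F (i, c)].

Definition strict_incr (n m : nat) (f : {ffun 'I_n -> 'I_m}) : bool :=
  [forall k : 'I_n, forall k' : 'I_n, (k < k') ==> (f k < f k')].

Definition maxl (x : seq nat) : nat := \max_(l <- x) l.

Definition contains (lam : seq nat) (F : filling lam) (x : seq nat) : bool :=
  [exists rho : {ffun 'I_(maxl x) -> 'I_(nrows lam)},
   exists col : {ffun 'I_(size x) -> 'I_(ncols lam)},
     [&& strict_incr rho, strict_incr col &
      [forall l : 'I_(maxl x), forall j : 'I_(size x),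
         in_shape lam (rho l) (col j) &&
         (F (rho l, col j) == (nth 0 x j == l.+1))]]].

Definition avoids (lam : seq nat) (F : filling lam) (x : seq nat) : bool :=
  ~~ contains F x.

Definition W (lam : seq nat) (a : seq nat) (Omega : seq (seq nat)) : {set filling lam} :=
  [set F : filling lam |
    [&& is_filling F,
        [forall c : 'I_(ncols lam), #|[pred i : 'I_(nrows lam) | F (i, c)]| == 1],
        [forall i : 'I_(nrows lam), #|[pred c : 'I_(ncols lam) | F (i, c)]| == nth 0 a i] &
        all (avoids F) Omega]].

(* Main.v *)
Require Import Defs.
From mathcomp Require Import all_boot zify.
Set Implicit Arguments. Unset Strict Implicit. Unset Printing Implicit Defensive.

(* Follow the border of the shape from the top left corner.  At each border point
   the columns to the left and the rows below cut out a word; entering a column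
   appends a letter and passing a row deletes the largest letters.  Standardize
   these words, with equal letters increasing for {231,221} and decreasing for
   {312,212}: only relative order matters, since the row of a letter is known
   when it is deleted.  The first family becomes 231-avoiding permutations with
   the letters of each row in increasing order, the second 312-avoiding ones with
   the letters of each row in decreasing order.

   Following Bloom and Saracino, label the border points: by the number of
   right-to-left minima in the first case, by one plus the number of inverse
   descents in the second.  In both cases the label sequences that occur are
   those with steps 0 or +1 on columns and 0 or -1 on rows, positive while there
   are letters, and never lower at the end of an excursion of the number of
   letters than at its beginning; tied deletions are those that lower the label.
   This is proved by letting the label sequence decide only progressively which
   state was reached: a sum of continuation counts over all states compatible
   with the labels seen so far obeys the same recursion in both cases. *)

(** * Label sequences *)

(* Steps of the border of the shape, read from its top left corner: [Col] enters
   a column, [Row k] leaves below the current top row, which must hold [k] ones. *)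
Inductive op := Col | Row of nat.

(** Among [k] tied letters there are [k - 1] pairs of neighbours, each tested on the mark of its
    larger letter; so the last mark removed is free. Here and below, [f] is the number of
    completions of a state. *)
Fixpoint pop (T : Type) (p : pred T) (k : nat) (f : seq T -> nat) (m : seq T) :=
  match k, m with
  | 0, _ => f m
  | 1, _ :: m' => f m'
  | k'.+1, c :: m' => if p c then pop p k' f m' else 0
  | _, [::] => 0
  end.

(** The leading run of [false] belongs to the letters above the last one. A new letter inserted
    above the last one puts its [true] somewhere in this run and destroys no minimum. *)
Fixpoint place (f : seq bool -> nat) (m : seq bool) : nat :=
  f (true :: m) + (if m is false :: m' then place (fun q => f (false :: q)) m' else 0).

(** The extra term is a new letter that takes the value of the last one and hides it: the old
    minimum is replaced by a new one, which amounts to one more [false] on top. *)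
Definition growA (f : seq bool -> nat) (m : seq bool) : nat :=
  (if m is [::] then 0 else f (false :: m)) + place f m.

(** A new letter may take the value of a letter with mark 2. The old letter moves up and precedes
    the new one, hence 0; the larger letters cannot keep a mark 2, since a smaller letter now stands
    last. *)
Fixpoint split_root (f : seq nat -> nat) (m : seq nat) : nat :=
  if m is c :: m' then
    if c == 2 then f [:: 0, 2 & m'] + split_root (fun q => f (1 :: q)) m'
    else split_root (fun q => f (c :: q)) m'
  else 0.

Definition growB (f : seq nat -> nat) (m : seq nat) : nat :=
  f (2 :: m) + split_root f m.

(* States list one mark per letter present, the largest letter first.  In
   [walksA] the letter is marked [true] iff it is a right-to-left minimum; see
   [mark] below for [walksB]. *)
Fixpoint walksA (s : seq op) (m : seq bool) : nat :=
  match s with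
  | [::] => m == [::]
  | Col :: s' => growA (walksA s') m
  | Row k :: s' => pop id k (walksA s') m
  end.

Fixpoint walksB (s : seq op) (m : seq nat) : nat :=
  match s with
  | [::] => m == [::]
  | Col :: s' => growB (walksB s') m
  | Row k :: s' => pop (pred1 0) k (walksB s') m
  end.

(* Sums of [f] over the states [m] of size [size y] reachable with current label
   [x], where [y] is the stack of labels that the border carried the last time
   there were [size y - 1], ..., [0] letters.  In [sumA] the label is the number
   of marks [true]; in [sumB] it is one plus the number of marks [0] (and [0] when
   there is no letter).  Repeated histories count with multiplicity in [sumB]. *)
Fixpoint sumA (y : seq nat) (x : nat) (f : seq bool -> nat) : nat :=
  match y with
  | [::] => if x == 0 then f [::] else 0
  | [:: _] => if x == 1 then f [:: true] else 0
  | y0 :: y' => (if y0 <= x then sumA y' x (fun m => f (false :: m)) else 0)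
              + (if y0 < x then sumA y' x.-1 (fun m => f (true :: m)) else 0)
  end.

Fixpoint sumB (y : seq nat) (x : nat) (f : seq nat -> nat) : nat :=
  match y with
  | [::] => if x == 0 then f [::] else 0
  | [:: _] => if x == 1 then f [:: 2] else 0
  | y0 :: y' =>
      if x == y0 then sumB y' x (fun m => f (2 :: m))
      else if y0 < x then
        sumB y' x.-1 (fun m => f (0 :: m)) + sumB y' x (fun m => f (1 :: m))
      else 0
  end.

(** The bottom entry belongs to the state without letters, so positivity is not asked of it. *)
Fixpoint label_stack (y : seq nat) (x : nat) : bool :=
  if y is y0 :: y' then [&& 0 < x, y0 <= x & label_stack y' y0] else true.

Lemma sumA_cons2 y0 y1 y x f : let y' := y1 :: y in
  sumA (y0 :: y') x f = (if y0 <= x then sumA y' x (fun m => f (false :: m)) else 0)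
                      + (if y0 < x then sumA y' x.-1 (fun m => f (true :: m)) else 0).
Proof. by []. Qed.

Lemma sumB_cons2 y0 y1 y x f : let y' := y1 :: y in
  sumB (y0 :: y') x f =
    if x == y0 then sumB y' x (fun m => f (2 :: m))
    else if y0 < x then
      sumB y' x.-1 (fun m => f (0 :: m)) + sumB y' x (fun m => f (1 :: m))
    else 0.
Proof. by []. Qed.

Lemma sumA_ext y x f g : f =1 g -> sumA y x f = sumA y x g.
Proof.
elim: y x f g => [|y0 [|y1 y] IHy] x f g fg; first by rewrite /= fg.
  by rewrite /= fg.
by rewrite !sumA_cons2; congr (_ + _); case: ifP => // _; apply: IHy => m; apply: fg.
Qed.

Lemma sumA_add y x f g : sumA y x (fun m => f m + g m) = sumA y x f + sumA y x g.
Proof.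
elim: y x f g => [|y0 [|y1 y] IHy] x f g; try by rewrite /=; case: ifP.
have E c z : sumA (y1 :: y) z (fun m => f (c :: m) + g (c :: m)) =
  sumA (y1 :: y) z (fun m => f (c :: m)) + sumA (y1 :: y) z (fun m => g (c :: m)).
  exact: IHy.
by rewrite !sumA_cons2 (E true) (E false); do 2?case: ifP => _; lia.
Qed.

Lemma sumB_add y x f g : sumB y x (fun m => f m + g m) = sumB y x f + sumB y x g.
Proof.
elim: y x f g => [|y0 [|y1 y] IHy] x f g; try by rewrite /=; case: ifP.
have E c z : sumB (y1 :: y) z (fun m => f (c :: m) + g (c :: m)) =
  sumB (y1 :: y) z (fun m => f (c :: m)) + sumB (y1 :: y) z (fun m => g (c :: m)).
  exact: IHy.
by rewrite !sumB_cons2 (E 0) (E 1) (E 2); do 2?case: ifP => _; lia.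
Qed.

Lemma sumA0 y x : sumA y x (fun _ => 0) = 0.
Proof.
elim: y x => [|y0 [|y1 y] IHy] x; try by rewrite /=; case: ifP.
by rewrite sumA_cons2 !IHy; do 2?case: ifP.
Qed.

Lemma sumB0 y x : sumB y x (fun _ => 0) = 0.
Proof.
elim: y x => [|y0 [|y1 y] IHy] x; try by rewrite /=; case: ifP.
by rewrite sumB_cons2 !IHy; do 2?case: ifP.
Qed.

Lemma label_stack_le y y0 x : label_stack y y0 -> 0 < x -> y0 <= x -> label_stack y x.
Proof. by case: y => //= y1 y /and3P[_ le1 ->] -> le0; rewrite (leq_trans le1 le0). Qed.

(** A column step that raises the label pushes the old label [x]. By induction on the stack: a top
    mark [false] lets the insertion go deeper, a top mark [true] stops it. *)
Lemma sumA_place y x f : y != [::] -> label_stack y x ->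
  sumA y x (place f) = sumA (x :: y) x.+1 f.
Proof.
(* Unfolding the top of the enlarged stack leaves sums over [y] itself, a form that goes through the
   induction. *)
move=> y_nil; have -> : sumA (x :: y) x.+1 f =
    sumA y x.+1 (fun m => f (false :: m)) + sumA y x (fun m => f (true :: m)).
  by case: y y_nil => // y0 y _; rewrite [LHS]/= leqnSn ltnSn.
elim: y x f y_nil => // y0 [|y1 y] IHy x f _.
  by case: x => //= x _; case: ifP => _; rewrite ?addn0.
move: IHy; set y' := y1 :: y => IHy /and3P[x_gt0 le0 st0].
have st : label_stack y' x by exact: (@label_stack_le y' y0 x st0).
rewrite !sumA_cons2 -/y' !ltnS le0 (leqW le0) [x.+1.-1]/=.
rewrite (@sumA_add y' x (fun m => f [:: true, false & m])
  (place (fun m => f (false :: m)))).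
rewrite (IHy _ (fun m => f (false :: m))) //.
rewrite (@sumA_ext y' x.-1 _ (fun m => f [:: true, true & m])); first by lia.
by move=> m; rewrite /= addn0.
Qed.

(** The counterpart of [sumA_place]: the label data change in the same way, so the two column steps
    can be compared. *)
Lemma sumB_split_root y x f : y != [::] -> label_stack y x ->
  sumB y x (split_root f) = sumB (x :: y) x.+1 f.
Proof.
move=> y_nil; have -> : sumB (x :: y) x.+1 f =
    sumB y x (fun m => f (0 :: m)) + sumB y x.+1 (fun m => f (1 :: m)).
  by case: y y_nil => // y0 y _; rewrite [LHS]/= ltnSn gtn_eqF.
elim: y x f y_nil => // y0 [|y1 y] IHy x f _.
  by case: x => //= x _; case: ifP => _; rewrite ?addn0.
move: IHy; set y' := y1 :: y => IHy /and3P[x_gt0 le0 st0].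
have st: label_stack y' x by exact: (@label_stack_le y' y0 x st0).
rewrite !sumB_cons2 -/y' ltnS le0 [x.+1 == _]gtn_eqF ?ltnS // [x.+1.-1]/=.
case: eqP => [_|/eqP x_ne].
  rewrite (@sumB_add y' x (fun m => f [:: 0, 2 & m])
    (split_root (fun m => f (1 :: m)))).
  by rewrite (IHy _ (fun m => f (1 :: m))) //; lia.
have lt0 : y0 < x by rewrite ltn_neqAle eq_sym x_ne.
have st' : label_stack y' x.-1.
  by apply: (@label_stack_le y' y0 _ st0); [case/and3P: st0 | ]; lia.
rewrite lt0 (IHy _ (fun m => f (0 :: m))) // (IHy _ (fun m => f (1 :: m))) //.
by rewrite prednK //; lia.
Qed.

(** Below the removed letter the label is [x], or [x - 1] if [y0 < x]. In both families a single
    removal sums over each possible label once, and a tied removal keeps only the lowered label. *)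
Lemma sum_pop k y x f g :
    (forall y x, label_stack y x -> sumA y x f = sumB y x g) ->
  label_stack y x -> sumA y x (pop id k f) = sumB y x (pop (pred1 0) k g).
Proof.
move=> fg; elim: k y x => [|k IHk] y x /=; first exact: fg.
case: y => [|y0 [|y1 y]] st.
- by rewrite /=; case: k IHk.
- case: k IHk st => [|k] IHk st; last by rewrite /=; case: ifP; case: k {IHk}.
  rewrite /=; case: ifP => // _.
  exact: (fg [::] 0).
set y' := y1 :: y; have /and3P[x_gt0 le0 st0] : [&& 0 < x, y0 <= x & label_stack y' y0] by [].
have y0_gt0 : 0 < y0 by case/and3P: st0.
have st1 : label_stack y' x by exact: (@label_stack_le y' y0 x st0).
have st2 : y0 < x -> label_stack y' x.-1 by move=> lt0; apply: (@label_stack_le y' y0 _ st0); lia.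
case: k IHk => [|k] IHk; rewrite sumA_cons2 sumB_cons2 -/y' le0.
  case: eqP => [->|/eqP x_ne]; first by rewrite ltnn addn0 fg.
  have lt0 : y0 < x by rewrite ltn_neqAle eq_sym x_ne.
  by rewrite lt0 !fg ?st2 // addnC.
rewrite sumA0; case: eqP => [->|/eqP x_ne]; first by rewrite ltnn sumB0.
have lt0 : y0 < x by rewrite ltn_neqAle eq_sym x_ne.
by rewrite lt0 sumB0 addn0 add0n; apply: IHk (st2 lt0).
Qed.

(** Both sums obey one recursion: a column pushes [x] and continues with label [x] or [x + 1], a row
    is [sum_pop]. *)
Lemma sum_walks s y x : label_stack y x -> sumA y x (walksA s) = sumB y x (walksB s).
Proof.
elim: s y x => [|[|k] s IHs] y x st.
- case: y {st} => [|y0 [|y1 y]]; try by rewrite /=; case: ifP.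
  have EA c z : sumA (y1 :: y) z (fun m => walksA [::] (c :: m)) = 0 by exact: sumA0.
  have EB c z : sumB (y1 :: y) z (fun m => walksB [::] (c :: m)) = 0 by exact: sumB0.
  by rewrite sumA_cons2 sumB_cons2 !EA !EB; do 3?case: ifP.
- case: y st => [|y0 y] st.
    case: x st => //= _; rewrite /growA /growB /= !addn0.
    by have := IHs [:: 0] 1 isT; rewrite /=.
  have x_gt0 : 0 < x by case/and3P: st.
  rewrite (@sumA_add (y0 :: y) x
    (fun m => if m is [::] then 0 else walksA s (false :: m)) (place (walksA s))).
  rewrite (@sumB_add (y0 :: y) x (fun m => walksB s (2 :: m)) (split_root (walksB s))).
  rewrite sumA_place // sumB_split_root //.
  rewrite (IHs _ x.+1); last by apply/and3P; split.
  congr (_ + _).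
  (* When the label stays at [x], the stack top [x] admits only the mark [false], respectively 2. *)
  have /IHs : label_stack (x :: y0 :: y) x by apply/and3P; split.
  rewrite sumA_cons2 sumB_cons2 leqnn ltnn eqxx addn0 => E.
  transitivity (sumA (y0 :: y) x (fun m => walksA s (false :: m))); last first.
    exact: E.
  by case: (y).
- exact: sum_pop.
Qed.

Lemma walks_eq s : walksA s [::] = walksB s [::].
Proof. exact: (@sum_walks s [::] 0). Qed.

(** * Walks on permutations *)

Definition permutes (u : seq nat) : bool := perm_eq u (iota 0 (size u)).
Definition before (u : seq nat) (a b : nat) : bool := index a u < index b u.
Definition insert_last (u : seq nat) (v : nat) : seq nat := rcons (map (bump v) u) v.
Definition below (m : nat) (u : seq nat) : seq nat := [seq a <- u | a < m].
Definition tops (n : nat) : seq nat := rev (iota 0 n).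

(* [v] may follow the word [y]: [bad] tests a pattern at the end of which [v]
   stands, through the comparisons first/second, first/last and second/last. *)
Definition allows (r : rel nat) (bad : bool -> bool -> bool -> bool) (y : seq nat) (v : nat) :=
  pairwise (fun a b => ~~ bad (r a b) (r a v) (r b v)) y.

Definition pattern_free (bad : bool -> bool -> bool -> bool) (u : seq nat) : Prop :=
  forall a b c, a < size u -> b < size u -> c < size u ->
    before u a b -> before u b c -> ~~ bad (a < b) (a < c) (b < c).

(* The [k] largest letters, which come from one row, appear in increasing order
   ([t = true]) or in decreasing order ([t = false]). *)
Definition ties (t : bool) (k : nat) (u : seq nat) : bool :=
  pairwise (fun a b => (a < b) == t) [seq a <- u | size u - k <= a].

Fixpoint perm_walks (t : bool) bad (s : seq op) (u : seq nat) : nat :=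
  match s with
  | [::] => u == [::]
  | Col :: s' =>
      \sum_(0 <= v < (size u).+1 | allows ltn bad u v) perm_walks t bad s' (insert_last u v)
  | Row k :: s' =>
      if (k <= size u) && ties t k u then perm_walks t bad s' (below (size u - k) u) else 0
  end.

(** * Permutations: appending a letter and deleting the largest letters *)

Lemma pairwise_filterE (T : Type) (p : pred T) (R : rel T) s :
  pairwise R (filter p s) = pairwise (fun a b => p a ==> p b ==> R a b) s.
Proof.
elim: s => //= c s IHs; case: ifP => pc /=; rewrite IHs; last by rewrite all_predT.
by congr (_ && _); rewrite all_filter.
Qed.

Lemma permutes_uniq u : permutes u -> uniq u.
Proof. by move/perm_uniq->; apply: iota_uniq. Qed.

Lemma mem_permutes u a : permutes u -> (a \in u) = (a < size u).
Proof. by move/perm_mem->; rewrite mem_iota. Qed.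

Lemma pairwise_beforeP u (R : rel nat) : permutes u ->
  reflect (forall a b, a < size u -> b < size u -> before u a b -> R a b) (pairwise R u).
Proof.
move=> pu; apply: (iffP (pairwiseP 0)) => [H a b au bu ab | H i j iu ju ij].
  have := H _ _ _ _ ab; rewrite !nth_index ?mem_permutes //.
  by apply; rewrite inE index_mem mem_permutes.
apply: H; rewrite -?mem_permutes ?mem_nth //.
by rewrite /before !index_uniq ?permutes_uniq.
Qed.

Lemma before_trans u : transitive (before u).
Proof. move=> a b c; exact: ltn_trans. Qed.

Lemma before_total u a b : permutes u -> a < size u -> b < size u ->
  a != b -> before u a b || before u b a.
Proof.
move=> pu au bu ab; rewrite /before -neq_ltn; apply: contraNneq ab => /index_inj ->;
  by rewrite ?mem_permutes.
Qed.

Lemma before_asym u a b : before u a b -> ~~ before u b a.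
Proof. by rewrite /before -leqNgt => /ltnW. Qed.

Lemma size_insert_last u v : size (insert_last u v) = (size u).+1.
Proof. by rewrite size_rcons size_map. Qed.

Lemma bump_inj v : injective (bump v).
Proof. exact: can_inj (@bumpK v). Qed.

Lemma bump_lt n v a : v <= n -> a < n -> bump v a < n.+1.
Proof. by rewrite /bump; lia. Qed.

Lemma bump_preimage n v a : v <= n -> a <= n -> a != v -> exists2 b, b < n & a = bump v b.
Proof. by move=> vn an av; exists (unbump v a); rewrite /bump /unbump; lia. Qed.

Lemma permutes_insert_last u v : permutes u -> v <= size u -> permutes (insert_last u v).
Proof.
move=> pu vu; apply: uniq_perm; rewrite ?iota_uniq //.
  rewrite rcons_uniq map_inj_uniq ?permutes_uniq ?andbT //; last exact: bump_inj.
  by apply/mapP=> -[b _]; rewrite /bump; lia.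
move=> a; rewrite mem_iota mem_rcons inE size_insert_last add0n ltnS /=.
case: (eqVneq a v) => [-> //|av] /=.
apply/mapP/idP=> [[b]|au]; last have [b bu ->] := bump_preimage vu au av.
  by rewrite mem_permutes // => bu ->; rewrite -ltnS bump_lt.
by exists b; rewrite ?mem_permutes.
Qed.

Lemma before_bump u v a b : permutes u -> a < size u -> b < size u ->
  before (insert_last u v) (bump v a) (bump v b) = before u a b.
Proof.
move=> pu au bu; rewrite /before /insert_last -cats1 !index_cat.
by rewrite !(mem_map (@bump_inj v)) !mem_permutes // au bu !(index_map (@bump_inj v)).
Qed.

Lemma bump_before_last u v a : permutes u -> a < size u -> before (insert_last u v) (bump v a) v.
Proof.
move=> pu au; rewrite /before /insert_last -cats1 !index_cat.
rewrite (mem_map (@bump_inj v)) mem_permutes // au (index_map (@bump_inj v)).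
case: ifP => [/mapP[b _]|_]; first by rewrite /bump; lia.
by rewrite size_map /= eqxx addn0 index_mem mem_permutes.
Qed.

Lemma last_not_before u v a : permutes u -> v <= size u -> a <= size u ->
  before (insert_last u v) v a = false.
Proof.
move=> pu vu au; case: (eqVneq a v) => [->|av]; first by rewrite /before ltnn.
have [b bu ->] := bump_preimage vu au av.
by apply: negbTE; apply: before_asym; apply: bump_before_last.
Qed.

Lemma below_permutes u m : permutes u -> m <= size u ->
  size (below m u) = m /\ permutes (below m u).
Proof.
move=> pu mu; have E : perm_eq (below m u) (iota 0 m).
  apply: uniq_perm; rewrite ?filter_uniq ?iota_uniq ?permutes_uniq // => a.
  by rewrite mem_filter mem_iota mem_permutes //; lia.
have sz : size (below m u) = m by rewrite (perm_size E) size_iota.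
by rewrite /permutes sz.
Qed.

Lemma before_filter (p : pred nat) u a b : a \in u -> p a -> p b ->
  before (filter p u) a b = before u a b.
Proof.
rewrite /before => + pa pb; elim: u => //= c u IHu; rewrite inE.
case: (eqVneq a c) => [<- _|ac /= /IHu {}IHu].
  by rewrite pa /= eqxx; case: (a == b).
case: (eqVneq c b) => [->|cb]; first by rewrite pb /= eqxx ltn0.
by case: ifP => _ //=; rewrite [c == a]eq_sym (negbTE ac) (negbTE cb) ltnS.
Qed.

Lemma before_below u m a b : permutes u -> m <= size u -> a < m -> b < m ->
  before (below m u) a b = before u a b.
Proof. by move=> pu mu am bm; apply: before_filter; rewrite ?mem_permutes //; lia. Qed.

Lemma pattern_free_insert_last bad u v : permutes u -> v <= size u ->
  allows ltn bad u v -> pattern_free bad u -> pattern_free bad (insert_last u v).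
Proof.
move=> pu vu /(pairwise_beforeP _ pu) ok pf a b c; rewrite size_insert_last !ltnS => au bu cu.
case: (eqVneq a v) => [-> |av]; first by rewrite last_not_before.
case: (eqVneq b v) => [-> |bv]; first by rewrite (last_not_before pu vu cu).
have [a' au' ->] := bump_preimage vu au av; have [b' bu' ->] := bump_preimage vu bu bv.
rewrite before_bump // => ab.
case: (eqVneq c v) => [-> _|cv].
  have := ok _ _ au' bu' ab; congr (~~ bad _ _ _); rewrite /= /bump; lia.
have [c' cu' ->] := bump_preimage vu cu cv; rewrite before_bump // => bc.
have := pf _ _ _ au' bu' cu' ab bc; congr (~~ bad _ _ _); rewrite /= /bump; lia.
Qed.

Lemma pattern_free_below bad u m : permutes u -> m <= size u ->
  pattern_free bad u -> pattern_free bad (below m u).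
Proof.
move=> pu mu pf a b c; have [-> _] := below_permutes pu mu => am bm cm.
by rewrite !before_below //; apply: pf; lia.
Qed.

Lemma topsS n : tops n.+1 = n :: tops n.
Proof. by rewrite /tops -addn1 iotaD rev_cat. Qed.

Lemma size_tops n : size (tops n) = n.
Proof. by rewrite size_rev size_iota. Qed.

Lemma mem_tops n i : (i \in tops n) = (i < n).
Proof. by rewrite mem_rev mem_iota. Qed.

Lemma topsD k v : tops (k + v) = [seq i + v | i <- tops k] ++ tops v.
Proof. by elim: k => // k IHk; rewrite addSn !topsS IHk. Qed.

Lemma drop_tops k n : k <= n -> drop k (tops n) = tops (n - k).
Proof.
move=> kn; rewrite -[in LHS](subnKC kn) topsD drop_cat size_map size_tops ltnn subnn.
by rewrite drop0.
Qed.

Lemma mem_take_tops k n i : (i \in take k (tops n)) = (n - k <= i < n).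
Proof.
case: (leqP k n) => kn.
  rewrite -[in LHS](subnKC kn) topsD take_cat size_map size_tops ltnn subnn take0 cats0.
  apply/mapP/idP=> [[j]|H]; first by rewrite mem_tops; lia.
  by exists (i - (n - k)); rewrite ?mem_tops; lia.
by rewrite take_oversize ?size_tops ?mem_tops; lia.
Qed.

Lemma nth_tops n i : i < n -> nth 0 (tops n) i = n - i.+1.
Proof. by move=> i_n; rewrite nth_rev size_iota // nth_iota; lia. Qed.

Lemma popE (T : Type) (p : pred T) k f m :
  pop p k f m = if (k <= size m) && all p (take k.-1 m) then f (drop k m) else 0.
Proof.
elim: k m => [|k IHk] m; first by rewrite /= ?take0 ?drop0.
case: m => [|c m]; first by case: k {IHk}.
case: k IHk => [|k] IHk; first by rewrite /= ?take0 ?drop0.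
rewrite -[LHS]/(if p c then pop p k.+1 f m else 0) IHk [size (_ :: _)]/= ltnS /=.
by case: (p c); rewrite ?andbF.
Qed.

(** The index [j] is the number of letters above the new one; its largest value, [e + 1], gives the
    term [f (false :: q)]. *)
Lemma growA_sum e m f : let q := nseq e false ++ true :: m in
  growA f q = \sum_(0 <= j < e.+2) f (nseq j false ++ true :: drop j q).
Proof.
have place_sum e' f' : place f' (nseq e' false ++ true :: m) =
    \sum_(0 <= j < e'.+1) f' (nseq j false ++ true :: drop j (nseq e' false ++ true :: m)).
  elim: e' f' => [|e' IHe] f'; first by rewrite /= big_nat1 addn0.
  by rewrite [LHS]/= big_nat_recl //= IHe.
rewrite /growA place_sum [RHS]big_nat_recr // addnC; congr (_ + _).
have -> : drop e.+1 (nseq e false ++ true :: m) = m.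
  by rewrite drop_cat size_nseq ltnNge leqnSn /= subSnn /= drop0.
by case: (e).
Qed.

Definition demote (c : nat) : nat := if c == 2 then 1 else c.

Lemma split_root_sum f m : split_root f m =
  \sum_(0 <= j < size m | nth 0 m j == 2)
     f (map demote (take j m) ++ [:: 0, 2 & drop j.+1 m]).
Proof.
elim: m f => [|c m IHm] f; first by rewrite big_nil.
rewrite /= big_mkcond big_nat_recl //= -big_mkcond /= drop0 !IHm.
case: eqP => [->|/eqP c2] /=; first by [].
by rewrite add0n /demote (negbTE c2).
Qed.

(** With [ltn] on distinct letters these tests are 231 and 312. Read through [wle], the weak order
    makes the first one cover 221 as well, and the strict order makes the second one cover 212. *)
Definition bad231 (ab ac bc : bool) : bool := [&& ab, ~~ ac & ~~ bc].
Definition bad312 (ab ac bc : bool) : bool := ~~ ac && bc.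

(** * Right-to-left minima of 231-avoiding permutations *)

Definition rl_min (u : seq nat) (i : nat) : bool :=
  all (fun b => before u i b ==> (i < b)) (iota 0 (size u)).

Definition rl_minima (u : seq nat) : seq bool := map (rl_min u) (tops (size u)).

Lemma rl_minP u i :
  reflect (forall b, b < size u -> before u i b -> i < b) (rl_min u i).
Proof.
apply: (iffP allP) => H b.
  by move=> bu ib; apply: (implyP (H b _) ib); rewrite mem_iota.
by rewrite mem_iota => bu; apply/implyP; apply: H.
Qed.

Lemma index_permutes u a : permutes u -> a < size u -> index a u < size u.
Proof. by move=> pu au; rewrite index_mem mem_permutes. Qed.

Lemma index_last_permutes u : permutes u -> 0 < size u ->
  last 0 u < size u /\ index (last 0 u) u = (size u).-1.
Proof.
move=> pu u0; have := mem_permutes (last 0 u) pu.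
case: u pu u0 => // c u pu _ /=; rewrite mem_last => <-; split=> //.
by rewrite -[LHS]/(index (last c u) (c :: u)) index_last // permutes_uniq.
Qed.

Lemma before_last u a : permutes u -> a < size u -> before u (last 0 u) a = false.
Proof.
move=> pu au; have u0 : 0 < size u by apply: leq_ltn_trans au.
have [_ il] := index_last_permutes pu u0.
have := index_permutes pu au; rewrite /before il; lia.
Qed.

Lemma last_after u a : permutes u -> a < size u -> a != last 0 u -> before u a (last 0 u).
Proof.
move=> pu au al; have u0 : 0 < size u by apply: leq_ltn_trans au.
have [lu _] := index_last_permutes pu u0.
by have := before_total pu au lu al; rewrite before_last ?orbF.
Qed.

(** The letters above the last one are followed by it, so they are not minima; the last letter
    always is one. *)
Lemma rl_minima_split u : permutes u -> 0 < size u ->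
  rl_minima u = nseq (size u - (last 0 u).+1) false
                  ++ true :: map (rl_min u) (tops (last 0 u)).
Proof.
move=> pu u0; have [lu il] := index_last_permutes pu u0.
set l := last 0 u in lu il *.
have l_after i : i < size u -> i != l -> before u i l by exact: last_after.
rewrite /rl_minima -[in tops (size u)](subnK lu) topsD map_cat topsS /=.
congr (_ ++ _ :: _); last first.
  by apply/rl_minP => b bu; rewrite before_last.
have E n (g : nat -> bool) : (forall i, i < n -> ~~ g i) -> map g (tops n) = nseq n false.
  elim: n => // n IHn gF; rewrite topsS /= IHn ?(negbTE (gF n _)) // => i i_n.
  exact/gF/ltnW.
rewrite -map_comp; apply: E => i iu /=.
apply/negP => /rl_minP/(_ _ lu); rewrite l_after; lia.
Qed.

Lemma rl_minima_insert_last u v : permutes u -> v <= size u ->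
  rl_minima (insert_last u v) = nseq (size u - v) false ++ true :: drop (size u - v) (rl_minima u).
Proof.
move=> pu vu; rewrite rl_minima_split ?permutes_insert_last ?size_insert_last //.
rewrite last_rcons subSS /rl_minima -map_drop drop_tops ?leq_subr // subKn //.
congr (_ ++ _ :: _); apply/eq_in_map => i; rewrite mem_tops => iv.
have iu : i < size u by lia.
have bi : i = bump v i by rewrite /bump; lia.
rewrite [in LHS]bi; apply/rl_minP/rl_minP => H b bu.
  move=> ib; have := H (bump v b); rewrite size_insert_last bump_lt // before_bump //.
  by move/(_ isT ib); rewrite /bump; lia.
move: bu; rewrite size_insert_last ltnS => bu; case: (eqVneq b v) => [->|bv].
  by rewrite -bi.
have [c cu ->] := bump_preimage vu bu bv; rewrite before_bump // => /(H _ cu).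
by rewrite /bump; lia.
Qed.

(** If [v] is smaller than the last letter [l], then the old letter [v], [l] and the new letter form
    231. If not, a 231 completed by the new letter would already be completed by [l]. *)
Lemma allows231 u v : permutes u -> pattern_free bad231 u -> 0 < size u -> v <= size u ->
  allows ltn bad231 u v = (last 0 u <= v).
Proof.
move=> pu pf u0 vu; have [lu il] := index_last_permutes pu u0.
set l := last 0 u in lu il *.
have l_after i : i < size u -> i != l -> before u i l by exact: last_after.
apply/(pairwise_beforeP _ pu)/idP => [ok|lv a b au bu ab].
  rewrite leqNgt; apply/negP => vl; have vu' : v < size u by lia.
  have /= := ok _ _ vu' lu (l_after _ vu' _); rewrite /bad231; lia.
have al : a != l.
  by apply: contraTneq ab => ->; rewrite before_last.
case: (eqVneq b l) => [->|bl]; first by rewrite /bad231 /=; lia.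
have := pf _ _ _ au bu lu ab (l_after _ bu bl); rewrite /bad231 /=; lia.
Qed.

Lemma rl_min_below u m i : permutes u -> m <= size u -> i < m ->
  rl_min (below m u) i = rl_min u i.
Proof.
move=> pu mu im; have [sz _] := below_permutes pu mu.
apply/rl_minP/rl_minP => H b bu; last first.
  by move: bu; rewrite sz => bm; rewrite before_below //; apply: H; lia.
case: (ltnP b m) => bm ib; last by lia.
by apply: H; rewrite ?sz ?before_below.
Qed.

Lemma tiesP t k u : permutes u ->
  reflect (forall a b, size u - k <= a < size u -> size u - k <= b < size u ->
             before u a b -> (a < b) = t) (ties t k u).
Proof.
move=> pu; rewrite /ties pairwise_filterE.
apply: (iffP (pairwise_beforeP _ pu)) => H a b.
  move=> /andP[ka au] /andP[kb bu] ab; have := H a b au bu ab.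
  by rewrite ka kb => /eqP.
by move=> au bu ab; apply/implyP => ka; apply/implyP => kb; rewrite H ?ka ?kb.
Qed.

(** A minimum has no smaller letter after it, which forces the increasing order. Conversely, in that
    order a smaller letter after a tied one would have to come from below the tied letters, against
    231-avoidance. *)
Lemma ties231 k u : permutes u -> pattern_free bad231 u -> k <= size u ->
  all id (take k.-1 (rl_minima u)) = ties true k u.
Proof.
move=> pu pf ku; rewrite -map_take all_map.
apply/allP/(tiesP _ _ pu) => [H a b au bu ab | H i].
  case: (eqVneq a b) => [E|ne]; first by move: ab; rewrite E /before ltnn.
  case: ltnP => // ba; have /H/rl_minP/= : a \in take k.-1 (tops (size u)).
    by rewrite mem_take_tops; lia.
  by case/andP: bu => _ bu /(_ b bu ab); rewrite ltnNge ba.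
rewrite mem_take_tops => iu /=; apply/rl_minP => z zu iz.
case: (ltnP i z) => // zi.
case: (leqP (size u - k) z) => kz.
  by have E := H i z _ _ iz; lia.
(* The smallest tied letter, [size u - k], precedes [i]; together with [i] and [z] it forms 231. *)
have m_u : size u - k < size u by lia.
have mi : before u (size u - k) i.
  have iu1 : i < size u by lia.
  have ne : size u - k != i by lia.
  case/orP: (before_total pu m_u iu1 ne) => // im.
  by have := H i (size u - k); rewrite im; lia.
have iu2 : i < size u by lia.
by have := pf _ _ _ m_u iu2 zu mi iz; rewrite /bad231; lia.
Qed.

Lemma perm_walks231 s u : permutes u -> pattern_free bad231 u ->
  perm_walks true bad231 s u = walksA s (rl_minima u).
Proof.
elim: s u => [|[|k] s IHs] u pu pf.
- by rewrite /=; case: u {pu pf}; rewrite // => c u; rewrite /rl_minima topsS.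
- transitivity (\sum_(0 <= v < (size u).+1 | allows ltn bad231 u v)
                 walksA s (rl_minima (insert_last u v))).
    rewrite [LHS]/= big_nat_cond [RHS]big_nat_cond; apply: eq_bigr => v.
    case/andP=> vu ok; rewrite IHs ?permutes_insert_last //.
    exact: pattern_free_insert_last.
  case: (posnP (size u)) => [/size0nil->|u0].
    by rewrite big_mkcond big_nat1 /= /growA /= addn0.
  have [lu _] := index_last_permutes pu u0.
  rewrite [RHS]/= [in RHS]rl_minima_split // growA_sum -rl_minima_split //.
  (* Reversal turns the index into [size u - v], the number of letters above the new one, as in
     [growA_sum]. The indices beyond [size u - last 0 u] are those that [allows231] rejects. *)
  rewrite big_nat_rev /= add0n big_mkcond /=.
  rewrite (@big_cat_nat _ _ _ (size u - last 0 u).+1) //=; last by lia.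
  rewrite [X in _ + X]big1_seq ?addn0; last first.
    move=> j; rewrite mem_index_iota => /andP[_ ju].
    by rewrite ?subSS allows231 ?leq_subr //; case: ifP => //; lia.
  have -> : (size u - (last 0 u).+1).+2 = (size u - last 0 u).+1 by lia.
  apply: eq_big_nat => j ju; rewrite ?subSS allows231 ?leq_subr // ifT; last by lia.
  by rewrite rl_minima_insert_last ?leq_subr // subKn //; lia.
rewrite /= popE size_map size_tops.
case: (leqP k (size u)) => //= ku; rewrite ties231 //; case: ifP => // _.
have [sz pb] := below_permutes pu (leq_subr k (size u)).
rewrite IHs //; last exact: pattern_free_below (leq_subr _ _) pf.
congr (walksA s _); rewrite /rl_minima -map_drop drop_tops // sz.
by apply/eq_in_map => i; rewrite mem_tops => iu; rewrite rl_min_below ?leq_subr.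
Qed.

(** * Marks of 312-avoiding permutations and inverse descents *)

(* [2]: all letters below [i] precede all letters from [i] on; otherwise [1] or
   [0] according to whether [i - 1] precedes [i]. *)
Definition mark (u : seq nat) (i : nat) : nat :=
  if allows ltn bad312 u i then 2 else before u i.-1 i.

Definition marks (u : seq nat) : seq nat := map (mark u) (tops (size u)).

Lemma allows312P u i : permutes u ->
  reflect (forall a b, a < size u -> b < size u -> before u a b -> i <= a -> i <= b)
          (allows ltn bad312 u i).
Proof.
move=> pu; apply: (iffP (pairwise_beforeP _ pu)) => H a b au bu ab.
  by have := H a b au bu ab; rewrite /bad312 /=; lia.
by have := H a b au bu ab; rewrite /bad312 /=; lia.
Qed.

(** The new letter [v] stands last, after all larger letters, so none of these has mark 2. The
    letter [v + 1], formerly [v], precedes [v]; still larger ones keep their order relative to their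
    predecessor in value. *)
Lemma mark_insert_last u v i : permutes u -> v <= size u -> i <= size u ->
    allows ltn bad312 u v ->
  mark (insert_last u v) i =
    if i < v then mark u i else if i == v then 2 else if i == v.+1 then 0
    else demote (mark u i.-1).
Proof.
move=> pu vu iu ok; have pi := permutes_insert_last pu vu.
have low j : j <= v -> allows ltn bad312 (insert_last u v) j = allows ltn bad312 u j.
  move=> jv; apply/(allows312P _ pi)/(allows312P _ pu); rewrite size_insert_last => H a b au bu.
    move=> ab ja; have := H _ _ (bump_lt vu au) (bump_lt vu bu); rewrite before_bump // ab.
    by rewrite /bump; lia.
  case: (eqVneq a v) => [->|av]; first by rewrite last_not_before.
  case: (eqVneq b v) => [->|bv]; first by lia.
  have [a' au' ->] := bump_preimage vu au av; have [b' bu' ->] := bump_preimage vu bu bv.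
  rewrite before_bump // => ab; have := H _ _ au' bu' ab; rewrite /bump; lia.
rewrite /mark; case: (ltnP i v) => [iv|vi].
  rewrite low ?(ltnW iv) //; case: ifP => // nok; congr (nat_of_bool _).
  rewrite -(@before_bump u v) //; try lia.
  by congr (before _ _ _); rewrite /bump; lia.
case: eqP => [->|/eqP i_v]; first by rewrite low // ok.
have [j ju ij] := bump_preimage vu iu i_v.
have vj : v <= j by move: ij; rewrite /bump; lia.
have {}ij : i = j.+1 by rewrite ij /bump vj.
rewrite ij /= eqSS.
have -> : allows ltn bad312 (insert_last u v) j.+1 = false.
  apply/negbTE/negP => /(allows312P _ pi) H; have := H (bump v j) v.
  rewrite size_insert_last (bump_lt vu ju) ltnS vu (bump_before_last v pu ju).
  by move/(_ isT isT isT); rewrite /bump vj; lia.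
case: eqP => [jv|/eqP jv]; first by rewrite jv last_not_before // -jv.
have -> : before (insert_last u v) j j.+1 = before u j.-1 j.
  by rewrite -(@before_bump u v) //; [congr (before _ _ _); rewrite /bump; lia | lia].
case: ifP => [/(allows312P _ pu) okj|_]; last by rewrite /demote; case: (before _ _ _).
rewrite /demote /=; have j1u : j.-1 < size u by lia.
have jn : j != j.-1 by lia.
by case/orP: (before_total pu ju j1u jn) => [/(okj _ _ ju j1u)|-> //]; lia.
Qed.

Lemma marks_insert_last u v : permutes u -> v < size u -> allows ltn bad312 u v ->
  marks (insert_last u v) =
    map demote (take (size u - v.+1) (marks u)) ++ [:: 0, 2 & drop (size u - v) (marks u)].
Proof.
move=> pu vu ok; have vu' := ltnW vu.
rewrite /marks size_insert_last -map_take -map_drop drop_tops ?leq_subr // subKn //.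
have -> : tops (size u).+1 = [seq i + v.+2 | i <- tops (size u - v.+1)] ++ tops v.+2.
  by rewrite -topsD; congr tops; lia.
have -> : take (size u - v.+1) (tops (size u)) = [seq i + v.+1 | i <- tops (size u - v.+1)].
  rewrite -[in tops (size u)](subnK vu) topsD take_cat size_map size_tops.
  by rewrite ltnn subnn take0 cats0.
rewrite map_cat !topsS /= -!map_comp.
have mk i : i <= size u -> _ := fun iu => mark_insert_last pu vu' iu ok.
congr (_ ++ _); last first.
  rewrite !mk // !ltnn ltnNge leqnSn /= !eqxx gtn_eqF //; congr [:: _, _ & _].
  by apply/eq_in_map => i; rewrite mem_tops => iv; rewrite mk ?iv //; lia.
apply/eq_in_map => i; rewrite mem_tops => iu /=; rewrite mk ?ifF; try lia.
by congr (demote (mark u _)); lia.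
Qed.

Lemma marks_insert_top u : permutes u -> marks (insert_last u (size u)) = 2 :: marks u.
Proof.
move=> pu; have ok : allows ltn bad312 u (size u).
  by apply/(allows312P _ pu) => a b; lia.
rewrite /marks size_insert_last topsS /= mark_insert_last // ltnn eqxx; congr (_ :: _).
by apply/eq_in_map => i; rewrite mem_tops => iu; rewrite mark_insert_last ?iu // ltnW.
Qed.

(** A deletion could only create a mark 2, by removing a letter [a] that preceded some [b < i]. If
    [i] precedes [b], the mark is still not 2; otherwise [a], [b], [i] form 312. *)
Lemma mark_below u m i : permutes u -> pattern_free bad312 u -> m <= size u -> i < m ->
  mark (below m u) i = mark u i.
Proof.
move=> pu pf mu im; have [sz pb] := below_permutes pu mu.
rewrite /mark before_below //; last by lia.
congr (if _ then _ else _); apply/(allows312P _ pb)/(allows312P _ pu); rewrite sz => H a b.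
  move=> au bu ab ia; case: (leqP i b) => // bi; have bm := ltn_trans bi im.
  case: (ltnP a m) => am; first by have := H a b am bm; rewrite before_below // ab; lia.
  have iu : i < size u by lia.
  have ne : i != b by lia.
  case/orP: (before_total pu iu bu ne).
    by move=> ib; have := H i b im bm; rewrite before_below // ib; lia.
  by move=> bi'; have := pf _ _ _ au bu iu ab bi'; rewrite /bad312; lia.
by move=> am bm; rewrite before_below // => ab; apply: H; lia.
Qed.

(** For [i > 0] the mark is 0 exactly when [i] precedes [i - 1], and such neighbours chain to a
    decreasing order of the tied letters. *)
Lemma ties312 k u : permutes u -> k <= size u ->
  all (pred1 0) (take k.-1 (marks u)) = ties false k u.
Proof.
move=> pu ku; rewrite -map_take all_map.
have mark0 i : 0 < i < size u -> (mark u i == 0) = before u i i.-1.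
  move=> iu; rewrite /mark; have iu1 : i.-1 < size u by lia.
  have iu2 : i < size u by lia.
  have ne : i != i.-1 by lia.
  case: ifP => [/(allows312P _ pu) ok|_].
    by apply/esym/negbTE/negP => /(ok _ _ iu2 iu1); lia.
  rewrite eqb0; apply/idP/idP; last by move/before_asym.
  by case/orP: (before_total pu iu2 iu1 ne) => // ->.
apply/allP/(tiesP _ _ pu) => [H a b au bu ab | H i].
  apply/negbTE/negP => lt_ab.
  have chain d : a + d < size u -> a + d = a \/ before u (a + d) a.
    elim: d => [|d IHd] ad; first by left; lia.
    right; have step : before u (a + d.+1) (a + d).
      have -> : a + d = (a + d.+1).-1 by lia.
      rewrite -mark0; last by lia.
      by apply: H; rewrite mem_take_tops; lia.
    by case: IHd => [|E|]; [lia | rewrite -{2}E | apply: before_trans].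
  have := chain (b - a); rewrite subnKC ?(ltnW lt_ab) //.
  by case; [lia | lia | move/before_asym; rewrite ab].
rewrite mem_take_tops => iu /=; rewrite mark0; last by lia.
have iu1 : i.-1 < size u by lia.
have iu2 : i < size u by lia.
have ne : i != i.-1 by lia.
case/orP: (before_total pu iu2 iu1 ne) => // before_i.
by have E := H i.-1 i _ _ before_i; lia.
Qed.

Lemma perm_walks312 s u : permutes u -> pattern_free bad312 u ->
  perm_walks false bad312 s u = walksB s (marks u).
Proof.
elim: s u => [|[|k] s IHs] u pu pf.
- by rewrite /=; case: u {pu pf}; rewrite // => c u; rewrite /marks topsS.
- transitivity (\sum_(0 <= v < (size u).+1 | allows ltn bad312 u v)
                 walksB s (marks (insert_last u v))).
    rewrite [LHS]/= big_nat_cond [RHS]big_nat_cond; apply: eq_bigr => v.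
    case/andP=> vu ok; rewrite IHs ?permutes_insert_last //.
    exact: pattern_free_insert_last.
  rewrite big_mkcond big_nat_recr //= ifT; last by apply/(allows312P _ pu) => a b; lia.
  rewrite marks_insert_top // /growB addnC; congr (_ + _).
  rewrite split_root_sum [in RHS]size_map size_tops.
  rewrite big_nat_rev [RHS]big_mkcond /= add0n; apply: eq_big_nat => j ju.
  have vu : size u - j.+1 < size u by lia.
  have -> : (nth 0 (marks u) j == 2) = allows ltn bad312 u (size u - j.+1).
    rewrite (nth_map 0) ?size_tops // nth_tops // /mark.
    by case: ifP => // _; case: (before _ _ _).
  case: ifP => // ok; rewrite marks_insert_last //.
  by congr (walksB s (map _ (take _ _) ++ [:: _, _ & drop _ _])); lia.
rewrite /= popE size_map size_tops.
case: (leqP k (size u)) => //= ku; rewrite ties312 //; case: ifP => // _.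
have [sz pb] := below_permutes pu (leq_subr k (size u)).
rewrite IHs //; last exact: pattern_free_below (leq_subr _ _) pf.
congr (walksB s _); rewrite /marks -map_drop drop_tops // sz.
by apply/eq_in_map => i; rewrite mem_tops => iu; rewrite mark_below ?leq_subr.
Qed.

(** * Standardization *)

(* The order used to standardize: weak when equal letters increase from left to
   right, strict when they decrease. *)
Definition wle (t : bool) (a b : nat) : bool := a < b + t.

Definition is_row (o : op) : bool := if o is Row _ then true else false.
Definition rows (s : seq op) : nat := count is_row s.
Definition cols (s : seq op) : nat := count (predC is_row) s.

Fixpoint word_walks (t : bool) bad (s : seq op) (y : seq nat) : nat :=
  match s with
  | [::] => y == [::]
  | Col :: s' =>
      \sum_(0 <= v < rows s' | allows (wle t) bad y v) word_walks t bad s' (rcons y v)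
  | Row k :: s' =>
      if count_mem (rows s') y == k then word_walks t bad s' (below (rows s') y) else 0
  end.

Fixpoint words (n h : nat) : seq (seq nat) :=
  if n is n'.+1 then [seq rcons w v | w <- words n' h, v <- iota 0 h] else [:: [::]].

Definition value (y u : seq nat) (a : nat) : nat := nth 0 y (index a u).

Definition standardizes (t : bool) (y u : seq nat) : bool :=
  (size y == size u) &&
  pairwise (fun a b => (a < b) == wle t (value y u a) (value y u b)) u.

Lemma mem_words n h w : (w \in words n h) = (size w == n) && all (gtn h) w.
Proof.
elim: n w => [|n IHn] w; first by case: w.
apply/allpairsP/idP => [[[x v] /= [+ + ->]]|].
  by rewrite IHn mem_iota size_rcons eqSS all_rcons /= => /andP[-> ->] ->.
case/lastP: w => // x v; rewrite size_rcons eqSS all_rcons /= => /and3P[sx vh ax].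
by exists (x, v); rewrite /= IHn sx ax mem_iota.
Qed.

Lemma words_uniq n h : uniq (words n h).
Proof.
elim: n => // n IHn; apply: allpairs_uniq; rewrite ?iota_uniq //.
by move=> [x v] [x' v'] _ _ /= /rcons_inj[-> ->].
Qed.

Lemma sum_reindex (I J : eqType) (A : seq I) (B : seq J) (P : pred I) (Q : pred J)
    (e : I -> J) (e' : J -> I) (F : J -> nat) : uniq A -> uniq B ->
    (forall a, a \in A -> P a -> [/\ e a \in B, Q (e a) & e' (e a) = a]) ->
    (forall b, b \in B -> Q b -> [/\ e' b \in A, P (e' b) & e (e' b) = b]) ->
  \sum_(a <- A | P a) F (e a) = \sum_(b <- B | Q b) F b.
Proof.
move=> uA uB AB BA; rewrite -big_filter -[RHS]big_filter -(big_map e predT F).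
apply: perm_big; apply: uniq_perm; rewrite ?filter_uniq //.
  rewrite map_inj_in_uniq ?filter_uniq // => a a'; rewrite !mem_filter.
  move=> /andP[Pa aA] /andP[Pa' aA'] E.
  by have [_ _ <-] := AB a aA Pa; have [_ _ <-] := AB a' aA' Pa'; rewrite E.
move=> b; apply/mapP/idP => [[a]|]; rewrite !mem_filter => /andP[].
  by move=> Pa aA ->; have [-> ->] := AB a aA Pa.
move=> Qb bB; have [e'A Pe' eK] := BA b bB Qb.
by exists (e' b); rewrite ?mem_filter ?Pe'.
Qed.

Lemma map_value y u : permutes u -> size y = size u -> map (value y u) u = y.
Proof.
move=> pu sz; apply: (@eq_from_nth _ 0); rewrite size_map // => i iu.
by rewrite (nth_map 0) // /value index_uniq ?permutes_uniq.
Qed.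

Lemma value_map g u a : permutes u -> a < size u -> value (map g u) u a = g a.
Proof. by move=> pu au; rewrite /value (nth_map 0) ?nth_index ?index_mem ?mem_permutes. Qed.

Lemma standardizesP t y u : permutes u -> size y = size u ->
  reflect (forall a b, a < size u -> b < size u -> before u a b ->
             (a < b) = wle t (value y u a) (value y u b))
          (standardizes t y u).
Proof.
move=> pu sz; rewrite /standardizes sz eqxx /=.
apply: (iffP (pairwise_beforeP _ pu)) => H a b au bu ab; first by have /eqP := H a b au bu ab.
by rewrite (H a b) //.
Qed.

Lemma value_monotone t y u a b : permutes u -> standardizes t y u ->
  a < size u -> b < size u -> a < b -> value y u a <= value y u b.
Proof.
move=> pu st au bu ab; have /eqP sz : size y == size u by case/andP: st.
have ne : a != b by lia.
have H := standardizesP t pu sz st.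
case/orP: (before_total pu au bu ne) => [/(H _ _ au bu)|/(H _ _ bu au)];
  by rewrite /wle; lia.
Qed.

Lemma initial_segment (P : pred nat) n :
    (forall a b, b < n -> a < b -> P b -> P a) ->
  forall a, a < n -> P a = (a < count P (iota 0 n)).
Proof.
elim: n => // n IHn dP a; rewrite ltnS -[in iota _ n.+1]addn1 iotaD count_cat /= add0n addn0 => an.
have {}IHn := IHn (fun a b bn => dP a b (ltnW bn)).
have cle : count P (iota 0 n) <= n by rewrite -[X in _ <= X](size_iota 0) count_size.
case: (boolP (P n)) => Pn.
  have all_P b : b < n -> P b by move=> bn; apply: dP Pn.
  have -> : count P (iota 0 n) = n.
    apply/eqP; rewrite -[X in _ == X](size_iota 0) -all_count.
    by apply/allP => b; rewrite mem_iota; apply: all_P.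
  have -> : P a by move: an; rewrite leq_eqVlt => /predU1P[->|/all_P].
  by rewrite addn1 ltnS an.
rewrite addn0; move: an; rewrite leq_eqVlt => /predU1P[->|/IHn//].
by rewrite (negbTE Pn) ltnNge cle.
Qed.

(** The letters in relation [wle t] to [v] form an initial segment in the order of [u]; its length
    is the value that [v] takes in the standardization when it is appended to [y]. *)
Lemma value_rank t y u v : permutes u -> standardizes t y u ->
  forall a, a < size u -> (a < count (wle t ^~ v) y) = wle t (value y u a) v.
Proof.
move=> pu st a au; have /eqP sz : size y == size u by case/andP: st.
rewrite -{1}(map_value pu sz) count_map (permP pu).
rewrite -(@initial_segment (preim (value y u) (wle t ^~ v))) // => b c cu bc /=.
by have := value_monotone pu st (ltn_trans bc cu) cu bc; rewrite /wle; lia.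
Qed.

Lemma value_bump y u v w a : permutes u -> size y = size u -> a < size u ->
  value (rcons y v) (insert_last u w) (bump w a) = value y u a.
Proof.
move=> pu sz au; rewrite /value /insert_last -[rcons (map _ _) _]cats1 index_cat.
rewrite (mem_map (@bump_inj w)) mem_permutes // au (index_map (@bump_inj w)).
by rewrite nth_rcons sz index_permutes.
Qed.

Lemma value_last y u v w : permutes u -> size y = size u ->
  value (rcons y v) (insert_last u w) w = v.
Proof.
move=> pu sz; rewrite /value /insert_last -[rcons (map _ _) _]cats1 index_cat.
case: ifP => [/mapP[b _]|_]; first by rewrite /bump; lia.
by rewrite size_map /= eqxx addn0 nth_rcons sz ltnn eqxx.
Qed.

Lemma standardizes_rcons t y u v w : permutes u -> size y = size u -> w <= size u ->
  standardizes t (rcons y v) (insert_last u w) =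
    standardizes t y u && all (fun a => (a < w) == wle t (value y u a) v) (iota 0 (size u)).
Proof.
move=> pu sz wu; have pw := permutes_insert_last pu wu.
have szw : size (rcons y v) = size (insert_last u w) by rewrite !size_rcons size_map sz.
apply/(standardizesP t pw szw)/idP => [H|/andP[/(standardizesP t pu sz) H1 /allP H2] a b].
  apply/andP; split.
    apply/(standardizesP t pu sz) => a b au bu ab.
    have := H (bump w a) (bump w b); rewrite size_insert_last !bump_lt // before_bump //.
    by rewrite !value_bump // => <- //; rewrite /bump; lia.
  apply/allP => a; rewrite mem_iota => au; apply/eqP.
  have := H (bump w a) w; rewrite size_insert_last bump_lt // ltnS wu.
  rewrite bump_before_last // value_bump // value_last // => <- //.
  by rewrite /bump; lia.
rewrite size_insert_last !ltnS => au bu.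
case: (eqVneq a w) => [->|aw]; first by rewrite last_not_before.
have [a' au' ->] := bump_preimage wu au aw.
case: (eqVneq b w) => [->|bw].
  rewrite value_bump // value_last // => _.
  have /eqP <- : (a' < w) == wle t (value y u a') v by apply: H2; rewrite mem_iota.
  by rewrite /bump; lia.
have [b' bu' ->] := bump_preimage wu bu bw.
rewrite before_bump // !value_bump // => ab; rewrite -H1 //; rewrite /bump; lia.
Qed.

Lemma allows_standardized t bad y u v : permutes u -> standardizes t y u ->
  allows ltn bad u (count (wle t ^~ v) y) = allows (wle t) bad y v.
Proof.
move=> pu st; have /eqP sz : size y == size u by case/andP: st.
rewrite /allows -[in RHS](map_value pu sz) pairwise_map.
have H := standardizesP t pu sz st.
by apply/(pairwise_beforeP _ pu)/(pairwise_beforeP _ pu) => ok a b au bu ab;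
  move: (ok a b au bu ab); rewrite /= !(value_rank v pu st) // H.
Qed.

(** Once [y] and [v] are fixed, exactly one [w] makes [insert_last u w] the standardization of
    [rcons y v], namely the rank of [v] in [y]; the double sum is regrouped by [w]. *)
Lemma sum_standardizes_col t bad u h (F : seq nat -> nat) : permutes u ->
  \sum_(y <- words (size u) h | standardizes t y u)
     \sum_(0 <= v < h | allows (wle t) bad y v) F (rcons y v) =
  \sum_(0 <= w < (size u).+1 | allows ltn bad u w)
     \sum_(z <- words (size u).+1 h | standardizes t z (insert_last u w)) F z.
Proof.
move=> pu.
transitivity (\sum_(0 <= w < (size u).+1) \sum_(y <- words (size u) h) \sum_(v <- iota 0 h)
   if allows ltn bad u w && standardizes t (rcons y v) (insert_last u w)
   then F (rcons y v) else 0); last first.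
  rewrite [RHS]big_mkcond; apply: eq_bigr => w _; case: ifP => ok; last first.
    by rewrite big1 // => y _; rewrite big1.
  by rewrite [RHS]big_mkcond big_allpairs_dep.
rewrite exchange_big big_mkcond big_seq [RHS]big_seq; apply: eq_bigr => y.
rewrite mem_words => /andP[/eqP sz _].
rewrite exchange_big /=; case: (boolP (standardizes t y u)) => st; last first.
  rewrite big1 // => v _; rewrite big_nat big1 // => w wu.
  by rewrite standardizes_rcons // (negbTE st) andbF.
rewrite big_mkcond /index_iota subn0; apply: eq_bigr => v _.
rewrite -(allows_standardized bad v pu st); set c := count _ y.
have cu : c < (size u).+1 by rewrite ltnS -sz count_size.
rewrite -/(index_iota 0 (size u).+1) (bigD1_seq c) ?mem_index_iota ?iota_uniq //=.
rewrite standardizes_rcons // st /= [X in _ && X](_ : _ = true) ?andbT; last first.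
  by apply/allP => a; rewrite mem_iota => au; rewrite (value_rank v pu st).
rewrite big1_seq ?addn0 // => w /andP[wc]; rewrite mem_index_iota => wu.
rewrite standardizes_rcons // st /=; case: allP => [H|]; rewrite ?andbF //.
have E a : a < size u -> (a < w) = (a < c).
  move=> au; rewrite (value_rank v pu st) //.
  by apply: (elimT eqP (H a _)); rewrite mem_iota.
case: (ltngtP w c) wc => // lt _.
  by have := E w; rewrite ltnn lt; lia.
by have := E c; rewrite ltnn lt; lia.
Qed.

(** Values grow weakly along [u], so the [k] copies of the largest available letter [h] sit at the
    [k] largest letters of [u]. *)
Lemma below_value t y u h k : permutes u -> standardizes t y u ->
    all (gtn h.+1) y -> count_mem h y = k ->
  [/\ k <= size u, forall a, a < size u -> (value y u a < h) = (a < size u - k)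
    & below h y = map (value y u) (below (size u - k) u)].
Proof.
move=> pu st yh ck; have /eqP sz : size y == size u by case/andP: st.
have ku : k <= size u by rewrite -ck -sz count_size.
have cb : count (gtn h) y = size u - k.
  have := count_predC (gtn h) y; rewrite sz => <-.
  rewrite -ck (_ : count (predC (gtn h)) y = count_mem h y) ?addnK //.
  by apply: eq_in_count => b /(allP yh) /=; lia.
have lt_h a : a < size u -> (value y u a < h) = (a < size u - k).
  move=> au; rewrite -cb -{2}(map_value pu sz) count_map (permP pu).
  rewrite -(@initial_segment (preim (value y u) (gtn h))) // => b c cu bc /=.
  by have := value_monotone pu st (ltn_trans bc cu) cu bc; lia.
split=> //; rewrite /below -{1}(map_value pu sz) filter_map.
by congr map; apply: eq_in_filter => a; rewrite mem_permutes //= => /lt_h.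
Qed.

(** Deleting the copies of [h] can be undone when [u] is known. Their places must satisfy [ties t],
    because [wle t h h] equals [t]. *)
Lemma sum_standardizes_row t u h k (F : seq nat -> nat) : permutes u ->
  \sum_(y <- words (size u) h.+1 | standardizes t y u && (count_mem h y == k)) F (below h y) =
  if (k <= size u) && ties t k u then
    \sum_(y <- words (size u - k) h | standardizes t y (below (size u - k) u)) F y
  else 0.
Proof.
move=> pu; set n := size u; set u' := below (n - k) u.
have [szu' pu'] := below_permutes pu (leq_subr k n); rewrite -/u' in szu' pu'.
have vals y a : standardizes t y u -> all (gtn h.+1) y -> count_mem h y = k ->
    a < n - k -> value (below h y) u' a = value y u a.
  move=> st yh ck au; have [ku _ ->] := below_value pu st yh ck.
  by rewrite value_map // szu'.
case: (boolP (_ && _)) => [/andP[ku tie]|no]; last first.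
  rewrite big1_seq // => y; rewrite mem_words => /andP[/andP[st /eqP ck] /andP[/eqP sz yh]].
  case/negP: no; have [ku lt_h _] := below_value pu st yh ck; rewrite ku /=.
  apply/(tiesP _ _ pu) => a b /andP[ka au] /andP[kb bu] ab.
  rewrite (standardizesP t pu sz st) //.
  have val_h c : n - k <= c -> c < n -> value y u c = h.
    move=> kc cu; have := lt_h c cu; have : value y u c < h.+1.
      by apply: (allP yh); rewrite -[in X in _ \in X](map_value pu sz) map_f ?mem_permutes.
    by lia.
  by rewrite !val_h // /wle; case: (t); lia.
(* The inverse map writes [h] at the places of the [k] largest letters of [u]. *)
pose e' y' := [seq if a < n - k then value y' u' a else h | a <- u].
apply: (@sum_reindex _ _ _ _ _ _ _ e'); rewrite ?words_uniq // => y.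
  rewrite !mem_words => /andP[/eqP sz yh] /andP[st /eqP ck].
  have [_ lt_h yE] := below_value pu st yh ck; split.
  - by rewrite yE size_map szu' eqxx -yE; apply/allP => a; rewrite mem_filter => /andP[].
  - have szy' : size (below h y) = size u' by rewrite yE size_map.
    apply/(standardizesP t pu' szy') => a b; rewrite szu' => ak bk.
    rewrite !vals // before_below ?leq_subr // => ab.
    by apply: (standardizesP t pu sz st) => //; apply: leq_trans (leq_subr k n).
  - rewrite -[RHS](map_value pu sz); apply/eq_in_map => a; rewrite mem_permutes // => au.
    case: ltnP => ak; first by rewrite vals.
    have := lt_h a au; have : value y u a < h.+1.
      by apply: (allP yh); rewrite -[in X in _ \in X](map_value pu sz) map_f ?mem_permutes.
    lia.
rewrite !mem_words => /andP[/eqP sz yh] st.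
have szy : size y = size u' by rewrite szu'.
have val_lt a : a < n - k -> value y u' a < h.
  move=> ak; apply: (allP yh); rewrite -[in X in _ \in X](map_value pu' szy).
  by rewrite map_f ?mem_permutes ?szu'.
have val_e a : a < n -> value (e' y) u a = if a < n - k then value y u' a else h.
  by move=> an; rewrite value_map.
have below_e : below h (e' y) = y.
  rewrite /below filter_map -[RHS](map_value pu' szy) [in RHS]/u' /below.
  rewrite (@eq_in_filter _ _ (gtn (n - k))) => [|a _ /=]; last first.
    by case: ifP => [/val_lt ->|]; rewrite ?ltnn.
  by apply/eq_in_map => a; rewrite mem_filter /= => /andP[->].
split=> //.
- rewrite size_map eqxx; apply/allP => _ /mapP[a _ ->] /=.
  by case: ifP => // /val_lt/ltnW.
- apply/andP; split.
    apply/(standardizesP t pu); rewrite ?size_map // => a b au bu ab.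
    rewrite !val_e //; case: (ltnP a (n - k)) => ak; case: (ltnP b (n - k)) => bk.
    + by apply: (standardizesP t pu' szy st); rewrite ?szu' ?before_below ?leq_subr.
    + by have := val_lt a ak; rewrite /wle; lia.
    + by have := val_lt b bk; rewrite /wle; lia.
    + rewrite (tiesP _ _ pu tie) ?ak ?bk // /wle; case: (t); lia.
  rewrite count_map -(eqn_add2l (n - k)) (subnK ku).
  rewrite -[X in X + _]szu' size_filter.
  rewrite (@eq_in_count _ (preim _ _) (predC (gtn (n - k)))) ?count_predC //.
  by move=> a _ /=; case: ifP => [/val_lt|]; rewrite ?eqxx; lia.
Qed.

(** One permutation stands for all words that it standardizes. At the empty permutation the only
    such word is empty, and the two counts agree. *)
Lemma sum_word_walks t bad s u : permutes u ->
  \sum_(y <- words (size u) (rows s) | standardizes t y u) word_walks t bad s y =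
  perm_walks t bad s u.
Proof.
elim: s u => [|[|k] s IHs] u pu.
- case: u pu => [|c u] pu; first by rewrite big_cons big_nil.
  rewrite [RHS]/= big1_seq // => y /andP[_].
  by rewrite mem_words => /andP[/eqP]; case: y.
- rewrite [LHS]/= sum_standardizes_col //=; rewrite big_nat_cond [RHS]big_nat_cond.
  apply: eq_bigr => w /andP[wu _].
  by rewrite -IHs ?permutes_insert_last // size_insert_last.
rewrite /= -big_mkcondr sum_standardizes_row //.
by case: ifP => // /andP[ku _]; have [sz pb] := below_permutes pu (leq_subr k (size u));
  rewrite -IHs // sz.
Qed.

Lemma word_walks_perm t bad s : word_walks t bad s [::] = perm_walks t bad s [::].
Proof. by rewrite -sum_word_walks //= big_cons big_nil addn0. Qed.

(** * Fillings and words *)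

Fixpoint heights (s : seq op) : seq nat :=
  match s with
  | [::] => [::]
  | Col :: s' => rows s' :: heights s'
  | Row _ :: s' => heights s'
  end.

(* Indexed from the bottom row, hence the [rcons]. *)
Fixpoint totals (s : seq op) : seq nat :=
  match s with
  | [::] => [::]
  | Col :: s' => totals s'
  | Row k :: s' => rcons (totals s') k
  end.

(** The walks counted by [word_walks], with their choices recorded: [w] lists the letters still to
    come. *)
Fixpoint fits (t : bool) bad (s : seq op) (y w : seq nat) : bool :=
  match s with
  | [::] => (y == [::]) && (w == [::])
  | Col :: s' =>
      if w is v :: w' then
        [&& v < rows s', allows (wle t) bad y v & fits t bad s' (rcons y v) w']
      else false
  | Row k :: s' => (count_mem (rows s') y == k) && fits t bad s' (below (rows s') y) w
  end.

Lemma perm_words_cons n h :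
  perm_eq (words n.+1 h) [seq v :: w | v <- iota 0 h, w <- words n h].
Proof.
apply: uniq_perm; rewrite ?words_uniq //.
  apply: allpairs_uniq; rewrite ?iota_uniq ?words_uniq //.
  by move=> [v w] [v' w'] _ _ /= [-> ->].
move=> w; rewrite mem_words; apply/idP/allpairsP => [|[[v x] /= [vh + ->]]].
  case: w => // v w; rewrite /= eqSS => /and3P[sw vh aw].
  by exists (v, w); rewrite /= mem_words sw aw mem_iota.
by move: vh; rewrite mem_words mem_iota /= eqSS => -> /andP[-> ->].
Qed.

(** The bound [h] is free because [rows s] drops at each row step while the alphabet of [w] stays
    fixed. *)
Lemma word_walks_count t bad s y h : rows s <= h ->
  word_walks t bad s y = count (fits t bad s y) (words (cols s) h).
Proof.
elim: s y => [|[|k] s IHs] y sh.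
- by rewrite /= andbT addn0.
- rewrite (permP (perm_words_cons (cols s) h)) -sum1_count big_mkcond big_allpairs_dep /=.
  rewrite /index_iota subn0.
  have -> : iota 0 h = index_iota 0 h by rewrite /index_iota subn0.
  have -> : iota 0 (rows s) = index_iota 0 (rows s) by rewrite /index_iota subn0.
  rewrite [RHS](@big_cat_nat _ _ _ (rows s)) //=.
  rewrite [X in _ + X]big1_seq ?addn0; last first.
    move=> v /andP[_]; rewrite mem_index_iota => vs; rewrite big1 // => w _.
    by rewrite ltnNge (proj1 (andP vs)).
  rewrite big_mkcond; apply: eq_big_nat => v vs; rewrite (proj2 (andP vs)) /=.
  case: ifP => ok /=; last by rewrite big1.
  by rewrite IHs // -sum1_count [LHS]big_mkcond.
rewrite /=; case: eqP => _ /=; first by rewrite IHs // ltnW.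
by rewrite count_pred0.
Qed.

Lemma heights_le_rows s c : c < cols s -> nth 0 (heights s) c <= rows s.
Proof.
elim: s c => [|[|k] s IHs] c //= cs; last exact/leqW/IHs.
by case: c cs => [|c] cs; rewrite /= ?IHs.
Qed.

Lemma size_totals s : size (totals s) = rows s.
Proof. by elim: s => [|[|k] s IHs] //=; rewrite size_rcons IHs. Qed.

Lemma below_id m y : all (gtn m) y -> below m y = y.
Proof. by move=> ym; apply/all_filterP. Qed.

Lemma below_cat m y z : below m (y ++ z) = below m y ++ below m z.
Proof. exact: filter_cat. Qed.

Lemma below_below m m' y : m' <= m -> below m' (below m y) = below m' y.
Proof.
by move=> mm; rewrite /below -filter_predI; apply: eq_filter => a /=; lia.
Qed.

(** Letters deleted before column [c] lie in rows at or above its height, so the state there is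
    recovered by filtering the whole prefix. *)
Lemma fitsP t bad s y w : all (gtn (rows s)) y ->
  reflect [/\ size w = cols s,
              forall c, c < cols s -> nth 0 w c < nth 0 (heights s) c,
              forall c, c < cols s ->
                allows (wle t) bad (below (nth 0 (heights s) c) (y ++ take c w)) (nth 0 w c)
            & forall i, i < rows s -> count_mem i (y ++ w) = nth 0 (totals s) i]
          (fits t bad s y w).
Proof.
elim: s y w => [|[|k] s IHs] y w ys.
- have -> : y = [::] by case: y ys.
  by apply: (iffP idP) => [/eqP-> //|[/size0nil-> _ _ _]].
- case: w => [|v w] /=; first by constructor; case.
  have ys' : v < rows s -> all (gtn (rows s)) (rcons y v) by move=> vs; rewrite all_rcons /= vs.
  apply: (iffP and3P) => [[vs ok /(IHs _ _ (ys' vs)) [sw wh wok wk]]|[[sw] wh wok wk]].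
    split; first by rewrite sw.
    - by case=> //= c /wh.
    - by case=> [_|c /wok] /=; [rewrite cats0 below_id | rewrite cat_rcons].
    - by move=> i /wk; rewrite cat_rcons.
  have vs := wh 0 isT; split=> //.
    by have := wok 0 isT; rewrite /= cats0 below_id.
  apply/(IHs _ _ (ys' vs)); split=> //.
  - by move=> c /(wh c.+1).
  - by move=> c /(wok c.+1); rewrite cat_rcons.
  - by move=> i /wk; rewrite cat_rcons.
have ys' : all (gtn (rows s)) (below (rows s) y).
  by apply/allP => a; rewrite mem_filter => /andP[].
have cnt i x : i < rows s -> count_mem i (below (rows s) y ++ x) = count_mem i (y ++ x).
  move=> iR; rewrite !count_cat; congr (_ + _); rewrite count_filter; apply: eq_count => a /=.
  by case: eqP => // ->.
have bel c x : c < cols s ->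
    below (nth 0 (heights s) c) (below (rows s) y ++ x) = below (nth 0 (heights s) c) (y ++ x).
  by move=> cs; rewrite !below_cat below_below ?heights_le_rows.
(* The columns still to come do not reach the row just passed, so its number of ones is final. *)
have cntR x : size x = cols s ->
    (forall c, c < cols s -> nth 0 x c < nth 0 (heights s) c) -> count_mem (rows s) x = 0.
  move=> sx xh; apply/count_memPn/negP => /(nthP 0)[c]; rewrite sx => cs xc.
  by have := leq_trans (xh c cs) (heights_le_rows cs); rewrite xc ltnn.
apply: (iffP andP) => [[/eqP ck /(IHs _ _ ys') [sw wh wok wk]]|[sw wh wok wk]].
  split=> // [c cs|i]; first by rewrite -bel ?wok.
  rewrite /= ltnS leq_eqVlt nth_rcons size_totals => /predU1P[->|iR].
    by rewrite ltnn eqxx count_cat ck cntR ?addn0.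
  by rewrite iR -cnt ?wk.
split.
  rewrite -[X in X == _]addn0 -(cntR w sw wh) -count_cat.
  by rewrite (wk (rows s) (leqnn _)) /= nth_rcons size_totals ltnn eqxx.
apply/(IHs _ _ ys'); split=> // [c cs|i iR]; first by rewrite bel ?wok.
by have := wk i (ltnW iR); rewrite /= nth_rcons size_totals iR cnt.
Qed.

(** * The border of a Ferrers shape *)

(** The bottom row heads [lam] but is passed last, after the columns that meet no other row. *)
Fixpoint border (lam a : seq nat) : seq op :=
  if lam is l :: lam' then
    border lam' (behead a) ++ nseq (l - head 0 lam') Col ++ [:: Row (head 0 a)]
  else [::].

Lemma rows_cat s1 s2 : rows (s1 ++ s2) = rows s1 + rows s2.
Proof. exact: count_cat. Qed.

Lemma cols_cat s1 s2 : cols (s1 ++ s2) = cols s1 + cols s2.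
Proof. exact: count_cat. Qed.

Lemma heights_cat s1 s2 :
  heights (s1 ++ s2) = [seq rows s2 + h | h <- heights s1] ++ heights s2.
Proof.
elim: s1 => [|[|k] s1 IHs] //=; rewrite IHs //.
by rewrite rows_cat addnC.
Qed.

Lemma totals_cat s1 s2 : totals (s1 ++ s2) = totals s2 ++ totals s1.
Proof. by elim: s1 => [|[|k] s1 IHs] /=; rewrite ?cats0 // IHs // rcons_cat. Qed.

Lemma size_heights s : size (heights s) = cols s.
Proof. by elim: s => [|[|k] s IHs] //=; rewrite IHs. Qed.

Lemma ferrers_cons l lam : ferrers (l :: lam) -> ferrers lam /\ head 0 lam <= l.
Proof.
case/andP=> /= so /andP[_ al]; rewrite /ferrers al andbT (path_sorted so); split=> //.
by case: lam so {al} => //= m lam /andP[].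
Qed.

Lemma nth_le_head lam i : ferrers lam -> nth 0 lam i <= head 0 lam.
Proof.
elim: lam i => [|l lam IHl] [|i] //= /ferrers_cons[fl hl].
exact: leq_trans (IHl i fl) hl.
Qed.

Lemma nth_ferrers lam i j : ferrers lam -> i <= j -> nth 0 lam j <= nth 0 lam i.
Proof.
elim: lam i j => [|l lam IHl] i j fl ij; first by rewrite !nth_nil.
have [fl' _] := ferrers_cons fl.
case: i ij => [|i] ij; first exact: (nth_le_head _ fl).
by case: j ij => // j ij; apply: IHl.
Qed.

Lemma in_shape_le lam i i' c c' : ferrers lam -> i' <= i -> c' <= c ->
  in_shape lam i c -> in_shape lam i' c'.
Proof.
move=> fl ii cc; rewrite /in_shape => H.
exact: leq_ltn_trans cc (leq_trans H (nth_ferrers fl ii)).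
Qed.

Lemma in_shape_bounds lam i c : ferrers lam -> in_shape lam i c ->
  i < nrows lam /\ c < ncols lam.
Proof.
rewrite /in_shape => fl ic; split; last exact: leq_trans ic (nth_le_head i fl).
by rewrite ltnNge; apply: contraTN ic => ?; rewrite nth_default.
Qed.

Lemma borderP lam a : ferrers lam ->
  [/\ rows (border lam a) = nrows lam, cols (border lam a) = ncols lam,
      forall c i, c < ncols lam -> (i < nth 0 (heights (border lam a)) c) = in_shape lam i c
    & forall i, i < nrows lam -> nth 0 (totals (border lam a)) i = nth 0 a i].
Proof.
rewrite /in_shape /nrows /ncols.
elim: lam a => [|l lam IHl] a fl; first by split.
have [fl' hl] := ferrers_cons fl.
have [R C H T] := IHl (behead a) fl'.
have r2 n k : rows (nseq n Col ++ [:: Row k]) = 1.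
  by rewrite rows_cat /rows count_nseq.
have c2 n k : cols (nseq n Col ++ [:: Row k]) = n.
  by elim: n => // n IHn; rewrite -[in RHS]IHn.
have h2 n k : heights (nseq n Col ++ [:: Row k]) = nseq n 1.
  by elim: n => //= n ->; rewrite r2.
have t2 n k : totals (nseq n Col ++ [:: Row k]) = [:: k] by elim: n.
split=> /=.
- by rewrite rows_cat R r2 addn1.
- by rewrite cols_cat C c2 subnKC.
- move=> c i cl; rewrite heights_cat r2 h2 nth_cat size_map size_heights C.
  case: (ltnP c (head 0 lam)) => ch.
    by rewrite (nth_map 0) ?size_heights ?C //; case: i => [|i] //=; rewrite add1n ltnS H.
  rewrite nth_nseq ltn_sub2r ?(leq_ltn_trans ch) //.
  case: i => [|i] //=; rewrite ltnS ltn0; apply/esym/negbTE; rewrite -leqNgt.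
  exact: leq_trans (nth_le_head i fl') ch.
move=> i il; rewrite totals_cat t2 /=; case: i il => [|i] /= il; first by rewrite nth0.
by rewrite T // nth_behead.
Qed.

(** * Pattern containment read off the rows of the ones *)

Definition filling_of (lam w : seq nat) : filling lam :=
  [ffun p : 'I_(nrows lam) * 'I_(ncols lam) => nth 0 w p.2 == p.1].

(** Each column has at most one 1, so its position fixes the column of the matrix. In a Ferrers
    shape all cells are present once the one in the highest row and last column is. Predecessors
    appear because pattern letters start at 1. *)
Lemma containsP lam w x : ferrers lam -> x != [::] -> all (fun l => 0 < l <= maxl x) x ->
  reflect (exists r c : nat -> nat,
     [/\ forall l l', l < l' < maxl x -> r l < r l',
         forall j j', j < j' < size x -> c j < c j',
         forall j, j < size x -> nth 0 w (c j) = r (nth 0 x j).-1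
       & in_shape lam (r (maxl x).-1) (c (size x).-1)])
    (contains (filling_of lam w) x).
Proof.
move=> fl x_nil xM.
have n_gt0 : 0 < size x by case: (x) x_nil.
have M_gt0 : 0 < maxl x.
  by have /andP[] := allP xM _ (mem_nth 0 n_gt0); apply: leq_trans.
apply: (iffP existsP) => [[rho /existsP[col /and3P[/forallP rI /forallP cI /forallP cell]]]|].
  (* Extended by 0 outside the range, where the values are never read. *)
  pose r l := if insub l is Some o then val (rho o) else 0.
  pose c j := if insub j is Some o then val (col o) else 0.
  have rE l (lM : l < maxl x) : r l = rho (Ordinal lM) by rewrite /r insubT.
  have cE j (jn : j < size x) : c j = col (Ordinal jn) by rewrite /c insubT.
  exists r, c; split.
  - move=> l l' /andP[ll lM]; have lM' := ltn_trans ll lM.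
    have /forallP/(_ (Ordinal lM))/implyP := rI (Ordinal lM').
    by rewrite (rE _ lM) (rE _ lM') => ->.
  - move=> j j' /andP[jj jn]; have jn' := ltn_trans jj jn.
    have /forallP/(_ (Ordinal jn))/implyP := cI (Ordinal jn').
    by rewrite (cE _ jn) (cE _ jn') => ->.
  - move=> j jn; have /andP[xj0 xjM] := allP xM _ (mem_nth 0 jn).
    have lM : (nth 0 x j).-1 < maxl x by rewrite prednK.
    have /forallP/(_ (Ordinal jn))/andP[_] := cell (Ordinal lM).
    by rewrite ffunE /= prednK // eqxx => /eqP/eqP; rewrite (cE _ jn) (rE _ lM).
  - have lM : (maxl x).-1 < maxl x by rewrite prednK.
    have jn : (size x).-1 < size x by rewrite prednK.
    have /forallP/(_ (Ordinal jn))/andP[+ _] := cell (Ordinal lM).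
    by rewrite (cE _ jn) (rE _ lM).
case=> r [c [rI cI xE sh]].
have r_le l : l < maxl x -> r l <= r (maxl x).-1.
  move=> lM; have : l <= (maxl x).-1 by rewrite -ltnS prednK.
  by rewrite leq_eqVlt => /predU1P[->//|ll]; apply/ltnW/rI; rewrite ll prednK /=.
have c_le j : j < size x -> c j <= c (size x).-1.
  move=> jn; have : j <= (size x).-1 by rewrite -ltnS prednK.
  by rewrite leq_eqVlt => /predU1P[->//|jj]; apply/ltnW/cI; rewrite jj prednK /=.
have [rR cC] := in_shape_bounds fl sh.
have rb (l : 'I_(maxl x)) : r l < nrows lam by apply: leq_ltn_trans (r_le l _) rR.
have cb (j : 'I_(size x)) : c j < ncols lam by apply: leq_ltn_trans (c_le j _) cC.
exists [ffun l => Ordinal (rb l)]; apply/existsP; exists [ffun j => Ordinal (cb j)].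
apply/and3P; split.
- by apply/forallP => l; apply/forallP => l'; apply/implyP => ll; rewrite !ffunE /= rI // ll /=.
- by apply/forallP => l; apply/forallP => l'; apply/implyP => ll; rewrite !ffunE /= cI // ll /=.
apply/forallP => l; apply/forallP => j; rewrite !ffunE /=; apply/andP; split.
  exact: in_shape_le fl (r_le l (ltn_ord l)) (c_le j (ltn_ord j)) sh.
rewrite xE //; have /andP[xj0 xjM] := allP xM _ (mem_nth 0 (ltn_ord j)).
have lM := ltn_ord l; apply/eqP; case: (ltngtP (nth 0 x j) l.+1) => xl.
- by apply/ltn_eqF/rI; rewrite lM andbT -ltnS prednK.
- by apply/gtn_eqF/rI; rewrite -ltnS prednK // xl.
- by rewrite xl /= eqxx.
Qed.

(** An occurrence ending in column [c] needs all its rows to meet that column; the earlier letters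
    that do so are the state of the walk on entering [c]. *)
Definition row_allows (t : bool) bad (lam w : seq nat) (c : nat) : bool :=
  allows (wle t) bad [seq b <- take c w | in_shape lam b c] (nth 0 w c).

Lemma row_allowsP t bad lam w c : c < size w ->
  reflect (forall i j, i < j < c -> in_shape lam (nth 0 w i) c -> in_shape lam (nth 0 w j) c ->
    ~~ bad (wle t (nth 0 w i) (nth 0 w j)) (wle t (nth 0 w i) (nth 0 w c))
           (wle t (nth 0 w j) (nth 0 w c)))
   (row_allows t bad lam w c).
Proof.
move=> cw; rewrite /row_allows /allows pairwise_filterE.
apply: (iffP (pairwiseP 0)); rewrite size_takel ?(ltnW cw) // => H i j.
  move=> /andP[ij jc] si sj; have ic := ltn_trans ij jc.
  by have := H i j ic jc ij; rewrite !nth_take // si sj.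
rewrite !inE => ic jc ij; rewrite !nth_take //.
by apply/implyP => si; apply/implyP => sj; apply: H; rewrite ?ij.
Qed.

Lemma contains_list lam w r0 r c0 c1 c2 x (v := fun k => nth 0 (r0 :: r) k) : ferrers lam ->
    size x = 3 -> all (fun l => 0 < l <= maxl x) x -> maxl x = (size r).+1 ->
    sorted ltn (r0 :: r) -> c0 < c1 -> c1 < c2 ->
    [seq nth 0 w c | c <- [:: c0; c1; c2]] = [seq v l.-1 | l <- x] ->
    in_shape lam (last r0 r) c2 ->
  contains (filling_of lam w) x.
Proof.
move=> fl sx xM Mx so c01 c12 wx sh; apply/containsP => //; first by case: (x) sx.
exists v, (nth 0 [:: c0; c1; c2]); rewrite Mx sx; split.
- move=> l l' /andP[ll lM]; apply: (sorted_ltn_nth ltn_trans 0 so) => //.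
  by rewrite inE (ltn_trans ll lM).
- case=> [|[|[|j]]] [|[|[|j']]] /= jj; lia.
- move=> j j3; rewrite -[RHS](nth_map 0 0 (fun l => v l.-1)) ?sx // -wx (nth_map 0) //.
- by rewrite /v /= -(last_nth 0).
Qed.

Lemma avoids231 lam w : ferrers lam -> size w = ncols lam ->
  all (avoids (filling_of lam w)) [:: [:: 2; 3; 1]; [:: 2; 2; 1]] =
  all (row_allows true bad231 lam w) (iota 0 (ncols lam)).
Proof.
move=> fl sw; rewrite /= andbT /avoids -negb_or; apply/idP/allP => [no c|ok].
  rewrite mem_iota add0n => /andP[_ cC]; apply/row_allowsP; rewrite ?sw // => i j.
  move=> /andP[ij jc] si sj; apply: contra no; rewrite /bad231 /wle !addn1 !ltnS -!ltnNge.
  case/and3P=> le_ij lt_ci lt_cj; apply/orP.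
  (* Equal first two letters give 221, unequal ones 231. *)
  move: le_ij; rewrite leq_eqVlt => /predU1P[E|lt_ij]; [right|left].
    by apply: (@contains_list _ _ (nth 0 w c) [:: nth 0 w i] i j c);
      rewrite /maxl /= ?big_cons ?big_nil //= ?E ?lt_cj.
  by apply: (@contains_list _ _ (nth 0 w c) [:: nth 0 w i; nth 0 w j] i j c);
    rewrite /maxl /= ?big_cons ?big_nil //= ?lt_ci ?lt_ij.
suff bad_pos i j c : i < j < c -> nth 0 w i <= nth 0 w j -> nth 0 w c < nth 0 w i ->
    in_shape lam (nth 0 w j) c -> False.
  apply/negP => /orP[] /containsP[] //=; rewrite ?/maxl ?big_cons ?big_nil //=.
    move=> r [c [rI cI xE sh]].
    apply: (bad_pos (c 0) (c 1) (c 2)); rewrite ?cI // ?(xE 0) ?(xE 1) ?(xE 2) //=.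
      by apply/ltnW/rI.
    exact: rI.
  move=> r [c [rI cI xE sh]].
  apply: (bad_pos (c 0) (c 1) (c 2)); rewrite ?cI // ?(xE 0) ?(xE 1) ?(xE 2) //=.
  exact: rI.
move=> ijc le_ij lt_ci sh; have [_ cC] := in_shape_bounds fl sh.
have cw : c < size w by rewrite sw.
have okc : row_allows true bad231 lam w c by apply: ok; rewrite mem_iota.
have := row_allowsP _ _ _ cw okc i j ijc.
move/(_ (in_shape_le fl le_ij (leqnn c) sh) sh).
by rewrite /bad231 /wle !addn1 !ltnS -!ltnNge le_ij lt_ci (leq_trans lt_ci le_ij).
Qed.

Lemma avoids312 lam w : ferrers lam -> size w = ncols lam ->
  all (avoids (filling_of lam w)) [:: [:: 3; 1; 2]; [:: 2; 1; 2]] =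
  all (row_allows false bad312 lam w) (iota 0 (ncols lam)).
Proof.
move=> fl sw; rewrite /= andbT /avoids -negb_or; apply/idP/allP => [no c|ok].
  rewrite mem_iota add0n => /andP[_ cC]; apply/row_allowsP; rewrite ?sw // => i j.
  move=> /andP[ij jc] si sj; apply: contra no; rewrite /bad312 /wle !addn0 -!leqNgt.
  case/andP=> le_ci lt_jc; apply/orP.
  (* Equal first and last letters give 212, unequal ones 312. *)
  move: le_ci; rewrite leq_eqVlt => /predU1P[E|lt_ci]; [right|left].
    by apply: (@contains_list _ _ (nth 0 w j) [:: nth 0 w c] i j c);
      rewrite /maxl /= ?big_cons ?big_nil //= ?E // -?E ?lt_jc.
  by apply: (@contains_list _ _ (nth 0 w j) [:: nth 0 w c; nth 0 w i] i j c);
    rewrite /maxl /= ?big_cons ?big_nil //= ?lt_jc ?lt_ci.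
(* Both patterns have their highest row at the first letter, so the shape condition is on the row of
   column [i]. *)
suff bad_pos i j c : i < j < c -> nth 0 w c <= nth 0 w i -> nth 0 w j < nth 0 w c ->
    in_shape lam (nth 0 w i) c -> False.
  apply/negP => /orP[] /containsP[] //=; rewrite ?/maxl ?big_cons ?big_nil //=.
    move=> r [c [rI cI xE sh]].
    apply: (bad_pos (c 0) (c 1) (c 2)); rewrite ?cI // ?(xE 0) ?(xE 1) ?(xE 2) //=.
      by apply/ltnW/rI.
    exact: rI.
  move=> r [c [rI cI xE sh]].
  apply: (bad_pos (c 0) (c 1) (c 2)); rewrite ?cI // ?(xE 0) ?(xE 1) ?(xE 2) //=.
  exact: rI.
move=> ijc le_ci lt_jc sh; have [_ cC] := in_shape_bounds fl sh.
have cw : c < size w by rewrite sw.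
have okc : row_allows false bad312 lam w c by apply: ok; rewrite mem_iota.
have := row_allowsP _ _ _ cw okc i j ijc sh.
have le_ji := leq_trans (ltnW lt_jc) le_ci.
move/(_ (in_shape_le fl le_ji (leqnn c) sh)).
by rewrite /bad312 /wle !addn0 -!leqNgt le_ci lt_jc.
Qed.

(** * Fillings with a single 1 per column as words *)

Definition word_of (lam : seq nat) (F : filling lam) : seq nat :=
  [seq oapp val 0 [pick i | F (i, c)] | c <- enum 'I_(ncols lam)].

Lemma nth_word_of lam (F : filling lam) (c : 'I_(ncols lam)) :
  nth 0 (word_of F) c = oapp val 0 [pick i | F (i, c)].
Proof. by rewrite /word_of (nth_map c) ?nth_ord_enum // size_enum_ord. Qed.

Lemma size_word_of lam (F : filling lam) : size (word_of F) = ncols lam.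
Proof. by rewrite size_map size_enum_ord. Qed.

Lemma filling_ofK lam w : w \in words (ncols lam) (nrows lam) ->
  word_of (filling_of lam w) = w.
Proof.
rewrite mem_words => /andP[/eqP sw wR]; apply: (@eq_from_nth _ 0).
  by rewrite size_word_of sw.
rewrite size_word_of => c cC; rewrite (nth_word_of _ (Ordinal cC)).
have wc : nth 0 w c < nrows lam by apply: (allP wR); rewrite mem_nth ?sw.
case: pickP => [i|/(_ (Ordinal wc))]; first by rewrite ffunE => /eqP.
by rewrite ffunE /= eqxx.
Qed.

Lemma word_ofK lam (F : filling lam) :
    [forall c : 'I_(ncols lam), #|[pred i : 'I_(nrows lam) | F (i, c)]| == 1] ->
  filling_of lam (word_of F) = F /\ word_of F \in words (ncols lam) (nrows lam).
Proof.
move/forallP=> F1.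
have uniqF c : exists i, [pick i | F (i, c)] = Some i /\ forall j, F (j, c) = (i == j).
  have /eqP := F1 c; case/mem_card1 => i Fi.
  have E j : F (j, c) = (i == j) by have := Fi j; rewrite !inE eq_sym.
  exists i; split=> //; case: pickP => [j|/(_ i)]; first by rewrite E => /eqP->.
  by rewrite E eqxx.
split.
  apply/ffunP => -[i c]; rewrite ffunE /= nth_word_of.
  by have [j [-> Fj]] := uniqF c; rewrite Fj.
rewrite mem_words size_word_of eqxx; apply/allP => _ /mapP[c _ ->].
by have [j [-> _]] := uniqF c; apply: (ltn_ord j).
Qed.

Lemma card_row lam w (i : 'I_(nrows lam)) : size w = ncols lam ->
  #|[pred c : 'I_(ncols lam) | filling_of lam w (i, c)]| = count_mem (val i) w.
Proof.
move=> sw; rewrite -[in RHS](mkseq_nth 0 w) sw /mkseq -val_enum_ord -map_comp count_map.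
rewrite cardE enumT size_filter; apply: eq_count => c.
by rewrite /= inE ffunE.
Qed.

(** The word of a filling fits the border exactly when the filling is admissible: the letters below
    the height of a column are the rows that meet it. *)
Lemma card_W t bad lam a Omega : ferrers lam ->
    (forall w, size w = ncols lam -> (forall c, c < ncols lam -> in_shape lam (nth 0 w c) c) ->
      all (avoids (filling_of lam w)) Omega =
      all (row_allows t bad lam w) (iota 0 (ncols lam))) ->
  #|W lam a Omega| = word_walks t bad (border lam a) [::].
Proof.
move=> fl avoid; have [R C H T] := borderP a fl.
rewrite (word_walks_count _ _ _ (leqnn _)) R C -sum1_card -sum1_count.
have fitsE w : w \in words (ncols lam) (nrows lam) ->
    fits t bad (border lam a) [::] w = (filling_of lam w \in W lam a Omega).
  rewrite mem_words => /andP[/eqP sw wR].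
  have wc_lt c : c < ncols lam -> nth 0 w c < nrows lam.
    by move=> cC; apply: (allP wR); rewrite mem_nth ?sw.
  have belowE c : c < ncols lam ->
      below (nth 0 (heights (border lam a)) c) (take c w) = [seq b <- take c w | in_shape lam b c].
    by move=> cC; apply: eq_filter => b; rewrite H.
  rewrite inE; apply/fitsP/and4P => // [[_ wh wok wk]|[/forallP fill _ /forallP tot av]].
    rewrite C in wh wok; rewrite R in wk.
    have win c : c < ncols lam -> in_shape lam (nth 0 w c) c by move=> cC; rewrite -(H c) ?wh.
    split.
    - apply/forallP => i; apply/forallP => c; rewrite ffunE /=; apply/implyP; apply: contraNN.
      by move/eqP <-; apply: win.
    - apply/forallP => c; apply/eqP; rewrite -(card1 (Ordinal (wc_lt c (ltn_ord c)))).
      by apply: eq_card => i; rewrite !inE ffunE /= eq_sym.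
    - apply/forallP => i; apply/eqP; rewrite card_row //.
      exact: etrans (wk _ (ltn_ord i)) (T _ (ltn_ord i)).
    - rewrite avoid //; apply/allP => c; rewrite mem_iota => cC.
      by rewrite /row_allows -belowE // wok.
  have win c : c < ncols lam -> in_shape lam (nth 0 w c) c.
    move=> cC; have /forallP/(_ (Ordinal cC)) := fill (Ordinal (wc_lt c cC)).
    by rewrite ffunE /= eqxx implybF negbK.
  rewrite C R; split=> //.
  - by move=> c cC; rewrite H ?win.
  - move=> c cC; move: av; rewrite avoid // => /allP/(_ c); rewrite mem_iota => /(_ cC).
    by rewrite /row_allows -belowE.
  - move=> i iR; have /eqP := tot (Ordinal iR); rewrite card_row //= => ->.
    by rewrite T.
apply/esym; apply: (@sum_reindex _ _ _ _ _ _ (filling_of lam) (@word_of lam) (fun=> 1)).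
- exact: words_uniq.
- exact: index_enum_uniq.
- by move=> w wW fw; rewrite mem_index_enum filling_ofK // -fitsE.
move=> F _ FW; have [FK Fw] : filling_of lam (word_of F) = F /\
    word_of F \in words (ncols lam) (nrows lam).
  by apply: word_ofK; move: FW; rewrite inE => /and4P[].
by split=> //; rewrite fitsE // FK.
Qed.

Theorem theorem14 (lam : seq nat) (a : seq nat) :
  ferrers lam -> all (fun k => 0 < k) a ->
  #|W lam a [:: [:: 2; 3; 1]; [:: 2; 2; 1]]| = #|W lam a [:: [:: 3; 1; 2]; [:: 2; 1; 2]]|.
Proof.
move=> fl _.
rewrite (@card_W true bad231) // => [|w sw _]; last exact: avoids231.
rewrite (@card_W false bad312) // => [|w sw _]; last exact: avoids312.
by rewrite !word_walks_perm perm_walks231 // perm_walks312 // walks_eq.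
Qed.
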